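(* There exist an open neighborhood $\mathcal{A}\subset R$ of $p_0$ such that the set $\mathcal{X}$ of points $z_0\in\mathcal{A}$ whose $\mathbf{W}$-orbit is defined for all $k$ and satisfies $z_k\to p_0$ has the following properties: $\mathcal{X}$ is closed in $\mathcal{A}$, has Lebesgue measure zero, and is invariant under $\mathbf{W}$; for every $z_0=(x_0,y_0)\in\mathcal{X}$ with $y_0\ne0$ the convergence is quadratic, i.e. there are constants $c,C>0$ with $c|y_k|^2\le|y_{k+1}|\le C|y_k|^2$ for all $k$, where $z_k=(x_k,y_k)$; and $\mathcal{X}\cap\{y>0\}$ is homeomorphic to the Cartesian product of a Cantor set and an open interval.
   Context: For $x>0$, $y\in\mathbb{R}$ let $r_1^2=4+x^2+4x^2y^2$, $\Delta=((x+2)^2+8x^2y^2)((x-2)^2+8x^2y^2)$ and $\omega_\pm(x,y)=\frac{x^2-4\pm\sqrt{\Delta}}{2r_1^2}$. Let $p_0=(2,0)$, $R=\{(x,y): x>0,\ 4-4y^2-x^2y^2-8x^2y^4\ge 0\}$, $R_+=R\cap((0,2]\times\mathbb{R})$, $R_-=R\cap([2,\infty)\times\mathbb{R})$, and $r$ the line $x=2$. Define $\mathbf{W}_\pm(x,y)=\left(\frac{1+\omega_\pm}{1-\omega_\pm}x,\ \frac{|\omega_\pm|}{1+\omega_\pm}y\right)$ on $R_\pm$, and $\mathbf{W}$ on $R\setminus(r\setminus\{p_0\})$ by $\mathbf{W}=\mathbf{W}_+$ for $x<2$, $\mathbf{W}=\mathbf{W}_-$ for $x>2$, $\mathbf{W}(p_0)=p_0$.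 (This is Wilkinson's step in bidiagonal coordinates $(x,y)$ for $3\times3$ symmetric tridiagonal matrices with spectrum $\{-1,0,1\}$; $p_0$ corresponds to the matrix with rows $(0,1,0),(1,0,0),(0,0,0)$ and $|y|$ is comparable to the $(3,2)$ entry.) The $\mathbf{W}$-orbit of $z_0$ is $z_{k+1}=\mathbf{W}(z_k)$, defined as long as no $z_k$ lies on $r\setminus\{p_0\}$. *)

(* Defs.v *)
From HB Require Import structures.
From mathcomp Require Import all_boot all_order all_algebra.
From mathcomp Require Import all_classical all_reals all_analysis.
Set Implicit Arguments. Unset Strict Implicit. Unset Printing Implicit Defensive.
Import Order.TTheory GRing.Theory Num.Theory.
Import numFieldNormedType.Exports.
Local Open Scope classical_set_scope.
Local Open Scope ring_scope.

Section Wilkinson.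
Variable R : realType.

Definition r1sq (x y : R) : R := 4 + x ^+ 2 + 4 * x ^+ 2 * y ^+ 2.

Definition Delta (x y : R) : R :=
  ((x + 2) ^+ 2 + 8 * x ^+ 2 * y ^+ 2) * ((x - 2) ^+ 2 + 8 * x ^+ 2 * y ^+ 2).

Definition omega_p (x y : R) : R :=
  (x ^+ 2 - 4 + Num.sqrt (Delta x y)) / (2 * r1sq x y).
Definition omega_m (x y : R) : R :=
  (x ^+ 2 - 4 - Num.sqrt (Delta x y)) / (2 * r1sq x y).

Definition p0 : R * R := (2, 0).

Definition regionR : set (R * R) :=
  [set z | 0 < z.1 /\
           0 <= 4 - 4 * z.2 ^+ 2 - z.1 ^+ 2 * z.2 ^+ 2 - 8 * z.1 ^+ 2 * z.2 ^+ 4].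

Definition W_p (z : R * R) : R * R :=
  let w := omega_p z.1 z.2 in
  ((1 + w) / (1 - w) * z.1, `|w| / (1 + w) * z.2).
Definition W_m (z : R * R) : R * R :=
  let w := omega_m z.1 z.2 in
  ((1 + w) / (1 - w) * z.1, `|w| / (1 + w) * z.2).

Definition domW : set (R * R) :=
  [set z | regionR z /\ ~ (z.1 = 2 /\ z.2 <> 0)].

(* W, extended arbitrarily (by p0) outside its domain; only its values on
   domW matter below. *)
Definition W (z : R * R) : R * R :=
  if z.1 < 2 then W_p z else if 2 < z.1 then W_m z else p0.

Definition Worbit (z0 : R * R) (k : nat) : R * R := iter k W z0.

Definition orbit_defined (z0 : R * R) : Prop := forall k, domW (Worbit z0 k).

Definition Xset (A : set (R * R)) : set (R * R) :=
  [set z0 | A z0 /\ orbit_defined z0 /\ Worbit z0 @ \oo --> p0].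

End Wilkinson.

Definition homeomorphic_sets (T U : topologicalType) (A : set T) (B : set U) :=
  exists (f : T -> U) (g : U -> T),
    [/\ (forall a, A a -> B (f a)) /\ (forall b, B b -> A (g b)),
        (forall a, A a -> g (f a) = a) /\ (forall b, B b -> f (g b) = b) &
        {within A, continuous f} /\ {within B, continuous g}].

(* Main.v *)
(** In the coordinates [h = ln (x / 2) / 2] and [r = |y| sqrt x] the map [W]
    becomes [(h, r) |-> (sg h (2 |h| - b), r sinh (b - |h|))], where [b >= 0] and
    [sinh b ^ 2 = sinh h ^ 2 + r ^ 2].  Near the origin an orbit that leaves the
    wedge [|h| <= 3 r] has [|h| - r] nondecreasing from then on, so it does not
    converge to [p0].  An orbit that stays in the wedge has [|h|] comparable to
    [r] and [r] is squared at each step up to constants, which gives quadratic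
    convergence.  For two such orbits with the same signs of [h] up to time [n]
    the step expands [h]-differences in the cone [|dr| <= |dh| / 4], hence
    [dh] is exponentially small in [n].  Conversely each sequence of signs is
    realized at each height [r]: a path crossing the wedge is mapped, on either
    half of the wedge, to a path crossing the wedge again.  So [X] with [y > 0] is
    parametrized by the sequence of signs and by [r].  Each section [y = const] is
    covered by [2 ^ n] intervals of length [O(4 ^ -n)], so it is null. *)
Require Import Defs.
From HB Require Import structures.
From mathcomp Require Import all_boot all_order all_algebra.
From mathcomp Require Import all_classical all_reals all_analysis.
From mathcomp Require Import ring lra.
Import Order.TTheory GRing.Theory Num.Theory.
Import numFieldNormedType.Exports.
Local Open Scope classical_set_scope.
Local Open Scope ring_scope.
Set Implicit Arguments.
Unset Strict Implicit.

(** * Hyperbolic sine and its inverse, with explicit bounds near 0 *)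

Section HyperbolicSine.
Variable R : realType.
Implicit Types s t u : R.

Definition sh t : R := (expR t - expR (- t)) / 2.
Definition ash s : R := ln (s + Num.sqrt (1 + s ^+ 2)).

Lemma shE t : sh t = (expR t - expR (- t)) / 2.
Proof. by []. Qed.

Lemma sh0 : sh 0 = 0.
Proof. by rewrite /sh oppr0 subrr mul0r. Qed.

Lemma shN t : sh (- t) = - sh t.
Proof. by rewrite /sh opprK -mulNr opprB. Qed.

(** It turns [sinh b ^ 2 = sinh h ^ 2 + r ^ 2] into products of nearly linear factors, so that most
    later estimates avoid the square root. *)
Lemma sh_mul_addB s t : sh (s + t) * sh (s - t) = sh s ^+ 2 - sh t ^+ 2.
Proof.
rewrite /sh !opprD opprK !expRD !expRN.
by field; rewrite !gt_eqF ?expR_gt0.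
Qed.

Lemma sh_lt s t : s < t -> sh s < sh t.
Proof.
move=> st.
have h1 : expR s < expR t by rewrite ltr_expR.
have h2 : expR (- t) < expR (- s) by rewrite ltr_expR ltrN2.
by rewrite /sh; lra.
Qed.

Lemma sh_le s t : s <= t -> sh s <= sh t.
Proof. by rewrite le_eqVlt => /predU1P[->//|/sh_lt/ltW]. Qed.

Lemma sh_ltE s t : (sh s < sh t) = (s < t).
Proof.
apply/idP/idP => [|/sh_lt//].
by rewrite !ltNge; apply: contra => /sh_le.
Qed.

Lemma sh_leE s t : (sh s <= sh t) = (s <= t).
Proof. by rewrite !leNgt sh_ltE. Qed.

Lemma sh_ge0 t : (0 <= sh t) = (0 <= t).
Proof. by rewrite -{1}sh0 sh_leE. Qed.

Lemma ash_arg_gt0 s : 0 < s + Num.sqrt (1 + s ^+ 2).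
Proof.
have s2 := sqr_ge0 s.
have q0 : 0 <= Num.sqrt (1 + s ^+ 2) by exact: sqrtr_ge0.
have qE : Num.sqrt (1 + s ^+ 2) ^+ 2 = 1 + s ^+ 2 by rewrite sqr_sqrtr//; lra.
rewrite -ltrBlDl sub0r (le_lt_trans (ler_norm _))// normrN -sqrtr_sqr.
by rewrite ltr_sqrt; lra.
Qed.

Lemma ashK s : sh (ash s) = s.
Proof.
have p0 := ash_arg_gt0 s.
have s2 := sqr_ge0 s.
have qE : Num.sqrt (1 + s ^+ 2) ^+ 2 = 1 + s ^+ 2 by rewrite sqr_sqrtr//; lra.
rewrite /sh /ash expRN lnK ?posrE//.
move: p0 qE; set q := Num.sqrt _ => p0 qE.
have -> : (s + q)^-1 = q - s.
  by apply: (mulIf (lt0r_neq0 p0)); rewrite mulVf ?lt0r_neq0//; lra.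
lra.
Qed.

Lemma continuous_sh : continuous sh.
Proof.
move=> t; apply: cvgMl; apply: cvgB; first exact: continuous_expR.
by apply: continuous_comp; [exact: continuousN | exact: continuous_expR].
Qed.

Lemma continuous_ash : continuous ash.
Proof.
move=> s; apply: continuous_comp; last exact/continuous_ln/ash_arg_gt0.
apply: cvgD; first exact: cvg_id.
apply: continuous_comp; last exact: sqrt_continuous.
apply: cvgD; first exact: cvg_cst.
exact: exprn_continuous.
Qed.

(** The only input is [1 + u <= expR u] at [u = t] and [u = - t]: as the two exponentials have
    product 1, this also bounds each of them from above. *)
Lemma sh_bounds t : 0 <= t <= 1 / 60 -> 99 / 100 * t <= sh t <= 101 / 100 * t.
Proof.
move=> /andP[t0 t1].
have e1 := expR_ge1Dx t; have e2 := expR_ge1Dx (- t).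
have e3 : expR t * expR (- t) = 1 by rewrite -expRD subrr expR0.
have p1 := expR_gt0 t; have p2 := expR_gt0 (- t).
move: e1 e2 e3 p1 p2; rewrite /sh; set a := expR t; set b := expR (- t).
move=> e1 e2 e3 p1 p2.
have tt : t * t <= t * (1 / 60) by rewrite ler_wpM2l.
have a1 : a * (1 - t) <= 1 by rewrite -e3 ler_wpM2l //; lra.
have b1 : (1 + t) * b <= 1 by rewrite -e3 ler_wpM2r //; lra.
have a2 : a <= 1 + 102 / 100 * t.
  by rewrite -(@ler_pM2r _ (1 - t)); [apply: (le_trans a1); lra | lra].
have b2 : b <= 1 - 98 / 100 * t.
  by rewrite -(@ler_pM2l _ (1 + t)); [apply: (le_trans b1); lra | lra].
by apply/andP; split; lra.
Qed.

Lemma sh_bound_sub s t : 0 <= s -> s <= 1 / 60 -> 0 <= t -> t <= 1 / 60 ->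
  `|sh s - sh t| <= 103 / 100 * `|s - t|.
Proof.
wlog st : s t / t <= s => [hw|] s0 s1 t0 t1.
  have [/hw|/ltW/hw] := leP t s; first exact.
  by rewrite distrC (distrC s); apply.
rewrite !ger0_norm ?subr_ge0 ?sh_leE//.
(* With [d = expR (- (s - t))], the differences of exponentials are [expR s] and [expR (- t)] times
   [1 - d], and [1 - d <= s - t]. *)
have dE : expR (- s) = expR (- t) * expR (- (s - t)) by rewrite -expRD; congr expR; lra.
have dE' : expR t = expR s * expR (- (s - t)) by rewrite -expRD; congr expR; lra.
have d1 := expR_ge1Dx (- (s - t)).
have e2 := expR_ge1Dx (- s).
have e3 : expR s * expR (- s) = 1 by rewrite -expRD subrr expR0.
have p1 : 0 <= expR s by exact: expR_ge0.
have q1 : 0 <= expR (- t) by exact: expR_ge0.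
have t1' : expR (- t) <= 1 by rewrite -expR0 ler_expR; lra.
have s1' : expR s <= 61 / 59.
  have : expR s * (59 / 60) <= 1.
    rewrite -[leRHS]e3 ler_wpM2l//.
    by apply: le_trans e2; lra.
  lra.
rewrite /sh dE dE'; set d := expR (- (s - t)) in d1 *.
have h1 : expR s * (1 - d) <= 61 / 59 * (s - t).
  by apply: (@le_trans _ _ (expR s * (s - t)));
    [rewrite ler_wpM2l//; lra | rewrite ler_wpM2r//; lra].
have h2 : expR (- t) * (1 - d) <= 1 * (s - t).
  by apply: (@le_trans _ _ (expR (- t) * (s - t)));
    [rewrite ler_wpM2l//; lra | rewrite ler_wpM2r//; lra].
lra.
Qed.

End HyperbolicSine.
Global Opaque sh ash.

(** * Estimates for one step in the coordinates [(h, r)] *)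

Section Estimates.
Variable R : realType.
Implicit Types h r : R.

Definition beta h r : R := ash (Num.sqrt (sh h ^+ 2 + r ^+ 2)).

Lemma sh_beta h r : sh (beta h r) = Num.sqrt (sh h ^+ 2 + r ^+ 2).
Proof. by rewrite ashK. Qed.

Lemma beta_ge0 h r : 0 <= beta h r.
Proof. by rewrite -sh_ge0 sh_beta sqrtr_ge0. Qed.

Lemma sqr_sh_beta h r : sh (beta h r) ^+ 2 = sh h ^+ 2 + r ^+ 2.
Proof. by rewrite sh_beta sqr_sqrtr// addr_ge0// sqr_ge0. Qed.

Lemma continuous_beta (T : topologicalType) (f g : T -> R) (x : T) :
  {for x, continuous f} -> {for x, continuous g} ->
  {for x, continuous (fun t => beta (f t) (g t))}.
Proof.
move=> cf cg; rewrite /continuous_at /beta.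
apply: (@continuous_comp _ _ _ (fun t => Num.sqrt (sh (f t) ^+ 2 + g t ^+ 2)) (@ash R));
  last exact: continuous_ash.
apply: (@continuous_comp _ _ _ (fun t => sh (f t) ^+ 2 + g t ^+ 2) (@Num.sqrt R));
  last exact: sqrt_continuous.
apply: cvgD.
  apply: (@continuous_comp _ _ _ (fun t => sh (f t)) (fun u => u ^+ 2));
    last exact: exprn_continuous.
  by apply: (@continuous_comp _ _ _ f (@sh R)) => //; exact: continuous_sh.
by apply: (@continuous_comp _ _ _ g (fun u => u ^+ 2)) => //; exact: exprn_continuous.
Qed.

Lemma betaN h r : beta (- h) r = beta h r.
Proof. by rewrite /beta shN sqrrN. Qed.

Lemma beta_ge h r : h <= beta h r.
Proof.
rewrite -sh_leE sh_beta (le_trans (ler_norm _))// -sqrtr_sqr.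
by rewrite ler_wsqrtr// lerDl sqr_ge0.
Qed.

Global Opaque beta.

Lemma sh_beta_mul h r : sh (beta h r + h) * sh (beta h r - h) = r ^+ 2.
Proof. by rewrite sh_mul_addB sqr_sh_beta addrC addKr. Qed.

(** The difference of the defining relations at two points: it bounds the variation of [beta]
    without derivatives. *)
Lemma sh_beta_mul2 h1 r1 h2 r2 :
  sh (beta h1 r1 + beta h2 r2) * sh (beta h1 r1 - beta h2 r2) =
  sh (h1 + h2) * sh (h1 - h2) + (r1 + r2) * (r1 - r2).
Proof.
rewrite (sh_mul_addB (beta h1 r1) (beta h2 r2)) (sh_mul_addB h1 h2).
rewrite [X in X - _ = _]sqr_sh_beta [X in _ - X = _]sqr_sh_beta.
by move: (sh h1) (sh h2) => S1 S2; ring.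
Qed.

Lemma sh_abs_bounds (t : R) : `|t| <= 1 / 60 ->
  99 / 100 * `|t| <= `|sh t| <= 101 / 100 * `|t|.
Proof.
wlog t0 : t / 0 <= t => [hw|].
  have [/hw//|/ltW t0] := leP 0 t.
  by rewrite -(normrN t) -(normrN (sh t)) -shN; apply: hw; lra.
by rewrite (ger0_norm t0) ger0_norm ?sh_ge0// => t1; apply: sh_bounds; lra.
Qed.

(** All arguments of [sh] stay below [1 / 60], so [sh_bounds] replaces [sh] by the identity up to
    one percent; [98 / 100] and [103 / 100] absorb the squares of [99 / 100] and [101 / 100]. *)
Lemma beta_bounds h r : 0 <= h -> h <= 1 / 10 / 100 -> 0 <= r -> r <= 1 / 100 / 100 ->
  let b := beta h r in
  [/\ b <= 1 / 3 / 100,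
      98 / 100 * ((b + h) * (b - h)) <= r ^+ 2 <= 103 / 100 * ((b + h) * (b - h)) &
      99 / 100 * (b - h) <= sh (b - h) <= 101 / 100 * (b - h)].
Proof.
move=> h0 h1 r0 r1 b.
have b0 : 0 <= b by exact: beta_ge0.
have hb : h <= b by exact: beta_ge.
have b1 : b <= 1 / 3 / 100.
  rewrite -sh_leE sh_beta.
  have /andP[+ _] : 99 / 100 * (1 / 3 / 100) <= sh (1 / 3 / 100 : R) <= 101 / 100 * (1 / 3 / 100).
    by apply: sh_bounds; lra.
  have /andP[_] : 99 / 100 * h <= sh h <= 101 / 100 * h by apply: sh_bounds; lra.
  have := h0; rewrite -sh_ge0; set S := sh h => S0 S1.
  apply: le_trans.
  rewrite -[leRHS]ger0_norm; last by lra.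
  rewrite -sqrtr_sqr ler_wsqrtr//.
  apply: (@le_trans _ _ ((S + r) ^+ 2)); last by rewrite lerXn2r ?nnegrE; lra.
  by rewrite sqrrD addrAC lerDl mulrn_wge0// mulr_ge0.
split=> //; last by apply: sh_bounds; lra.
rewrite -(sh_beta_mul h r) -/b.
have /andP[p1 p2] : 99 / 100 * (b + h) <= sh (b + h) <= 101 / 100 * (b + h).
  by apply: sh_bounds; lra.
have /andP[q1 q2] : 99 / 100 * (b - h) <= sh (b - h) <= 101 / 100 * (b - h).
  by apply: sh_bounds; lra.
have u0 : 0 <= b + h by lra.
have v0 : 0 <= b - h by lra.
have uv := mulr_ge0 u0 v0.
apply/andP; split.
  apply: (@le_trans _ _ ((99 / 100 * (b + h)) * (99 / 100 * (b - h)))); first by lra.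
  by apply: ler_pM => //; lra.
apply: (@le_trans _ _ ((101 / 100 * (b + h)) * (101 / 100 * (b - h)))); last by lra.
by apply: ler_pM => //; lra.
Qed.

(** Outside the wedge, [h] loses at most [r / 5] while [r] loses almost all of itself, so [h - r]
    cannot drop and the slope condition is reproduced. *)
Lemma escape_step h r : 0 < h -> h <= 1 / 10 / 100 -> 0 <= r -> r <= 1 / 100 / 100 ->
  3 * r <= h ->
  let b := beta h r in let r' := r * sh (b - h) in
  [/\ 0 < 2 * h - b, 2 * h - b <= h, 3 * r' <= 2 * h - b, 0 <= r' <= r &
      h - r <= 2 * h - b - r'].
Proof.
move=> h0 h1 r0 r1 rh b r'.
have hb : h <= b by exact: beta_ge.
have [b1 /andP[c1 c2] /andP[d1 d2]] := beta_bounds (ltW h0) h1 r0 r1.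
rewrite -/b in b1 c1 c2 d1 d2.
(* [2 h (b - h) <= (b + h) (b - h)], which is at most about [r ^ 2 <= r h / 3]; division by [2 h]
   gives about [r / 6]. *)
have e : b - h <= 1 / 5 * r.
  rewrite -(@ler_pM2l _ (h * 2))//; last by lra.
  have k1 : 0 <= (b - h) ^+ 2 by exact: sqr_ge0.
  have k2 : r * r <= r * (h / 3) by rewrite ler_wpM2l//; lra.
  have k3 : 0 <= r * h by rewrite mulr_ge0// ltW.
  by move: c1 k1; rewrite !expr2; lra.
have r'0 : 0 <= r' by rewrite mulr_ge0//; lra.
have r'1 : r' <= r * (1 / 100) by rewrite ler_wpM2l//; lra.
clear -h0 hb e r0 rh r'0 r'1.
by split; [lra|lra|lra|apply/andP; split; lra|lra].
Qed.

(** In the wedge [b ^ 2] is at most about [10 r ^ 2], hence [b + h <= 25 / 4 r]. As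
    [(b + h) (b - h)] is close to [r ^ 2], [b - h] is comparable to [r], and so [r'] to [r ^ 2]. *)
Lemma wedge_step h r : 0 <= h -> h <= 1 / 10 / 100 -> 0 <= r -> r <= 1 / 100 / 100 ->
  h <= 3 * r ->
  let b := beta h r in let r' := r * sh (b - h) in
  [/\ b <= 13 / 4 * r, r ^+ 2 / 10 <= r' <= 5 * r ^+ 2 & r' <= r / 20 / 100].
Proof.
move=> h0 h1 r0 r1 rh b r'.
have hb : h <= b by exact: beta_ge.
have [b1 /andP[c1 c2] /andP[d1 d2]] := beta_bounds h0 h1 r0 r1.
rewrite -/b in b1 c1 c2 d1 d2.
have bE : (b + h) * (b - h) = b ^+ 2 - h ^+ 2 by ring.
have hh : h ^+ 2 <= (3 * r) ^+ 2 by rewrite lerXn2r ?nnegrE; lra.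
have b2 : b <= 13 / 4 * r.
  rewrite -(@ler_pXn2r _ 2)// ?nnegrE; [|by lra|by lra].
  have k := sqr_ge0 r.
  by move: c1 hh; rewrite bE !exprMn; lra.
have f1 : r * (b - h) <= r * (13 / 4 * r) by rewrite ler_wpM2l//; lra.
have f2 : r' <= r * (101 / 100 * (b - h)) by rewrite ler_wpM2l.
have f3 : r * (99 / 100 * (b - h)) <= r' by rewrite ler_wpM2l.
have f4 : (b + h) * (b - h) <= (25 / 4 * r) * (b - h) by rewrite ler_wpM2r//; lra.
have f5 : r * r <= r * (1 / 100 / 100) by rewrite ler_wpM2l//; lra.
split=> //; last by lra.
by rewrite expr2; move: c2; rewrite expr2 => c2; apply/andP; split; lra.
Qed.

(** If [2 h - b] is tiny then [b] is nearly [2 h], so [3 h ^ 2] is nearly [r ^ 2] and [h / r] is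
    near [1 / sqrt 3 = 0.577...]. *)
Lemma strip_bounds h r : 0 <= h -> h <= 1 / 10 / 100 -> 0 < r -> r <= 1 / 100 / 100 ->
  `|2 * h - beta h r| <= 3 / 20 / 100 * r -> 9 / 20 * r <= h <= 13 / 20 * r.
Proof.
move=> h0 h1 r0 r1; set b := beta h r => hb'.
have hb : h <= b by exact: beta_ge.
have [b1 /andP[c1 c2] _] := beta_bounds h0 h1 (ltW r0) r1.
rewrite -/b in b1 c1 c2.
move: hb'; rewrite ler_norml => /andP[g1 g2].
have rr : 0 < r * r by rewrite mulr_gt0.
rewrite expr2 in c1 c2.
apply/andP; split; rewrite leNgt; apply/negP => hr.
  have : (b + h) * (b - h) <= (28 / 20 * r) * (10 / 20 * r) by apply: ler_pM; lra.
  lra.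
have : (38 / 20 * r) * (12 / 20 * r) <= (b + h) * (b - h) by apply: ler_pM; lra.
lra.
Qed.

(** Since [b] is at least about [r], a point close to the axis is thrown across it, beyond the
    opposite edge of the much thinner wedge at the new height. *)
Lemma inner_step h r : 0 <= h -> h <= 1 / 10 / 100 -> 0 < r -> r <= 1 / 100 / 100 ->
  h <= 3 / 10 * r -> 2 * h - beta h r <= - (3 / 10) * r.
Proof.
move=> h0 h1 r0 r1 hr; set b := beta h r.
have hb : h <= b by exact: beta_ge.
have [b1 /andP[c1 c2] _] := beta_bounds h0 h1 (ltW r0) r1.
rewrite -/b in b1 c1 c2.
have rr : 0 < r * r by rewrite mulr_gt0.
rewrite expr2 in c1 c2.
suff : 9 / 10 * r <= b by lra.
rewrite leNgt; apply/negP => br.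
have h2 : 0 <= h ^+ 2 by exact: sqr_ge0.
have : b ^+ 2 <= (9 / 10 * r) ^+ 2 by rewrite lerXn2r ?nnegrE; lra.
have bE : (b + h) * (b - h) = b ^+ 2 - h ^+ 2 by ring.
by move: c2; rewrite bE exprMn (expr2 r); lra.
Qed.

(** Here [b1 + b2] is close to [2 (h1 + h2)] and [r1 + r2 <= 20 / 9 (h1 + h2)]. In the cone,
    [sh_beta_mul2] then gives [|db| <= 9 / 10 |dh|], the ideal factor being [(1 + 5 / 9) / 2]. So
    [|2 dh - db| >= |dh|], and the heights differ little because [sh (b1 - h1)] and [r2] are
    small. *)
Lemma cone_step h1 r1 h2 r2 :
  0 < r1 -> r1 <= 1 / 100 / 100 -> 0 < r2 -> r2 <= 1 / 100 / 100 ->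
  9 / 20 * r1 <= h1 <= 13 / 20 * r1 -> 9 / 20 * r2 <= h2 <= 13 / 20 * r2 ->
  let b1 := beta h1 r1 in let b2 := beta h2 r2 in
  `|2 * h1 - b1| <= 3 / 20 / 100 * r1 -> `|2 * h2 - b2| <= 3 / 20 / 100 * r2 ->
  `|r1 - r2| <= `|h1 - h2| / 4 ->
  `|h1 - h2| <= `|(2 * h1 - b1) - (2 * h2 - b2)| /\
  `|r1 * sh (b1 - h1) - r2 * sh (b2 - h2)| <= `|h1 - h2| / 4.
Proof.
move=> r10 r11 r20 r21 /andP[h11 h12] /andP[h21 h22] b1 b2.
move=> + + cone; rewrite ler_norml => /andP[s11 s12].
rewrite ler_norml => /andP[s21 s22].
have [d10 d11] : 0 <= b1 - h1 /\ b1 - h1 <= 1 / 100.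
  by split; [clear -r10 h11 s12 | clear -r10 r11 h12 s11]; lra.
have [d20 d21] : 0 <= b2 - h2 /\ b2 - h2 <= 1 / 100.
  by split; [clear -r20 h21 s22 | clear -r20 r21 h22 s21]; lra.
have [D1 D1'] : 0 <= sh (b1 - h1) /\ sh (b1 - h1) <= 1 / 10.
  have /andP[] : 99 / 100 * (b1 - h1) <= sh (b1 - h1) <= 101 / 100 * (b1 - h1).
    by apply: sh_bounds; clear -d10 d11; lra.
  by clear -d10 d11 => ? ?; split; lra.
have hs : 0 < h1 + h2 <= 1 / 10 / 20 by clear -r10 r11 r20 r21 h11 h12 h21 h22; lra.
have rs : r1 + r2 <= 20 / 9 * (h1 + h2) by clear -h11 h21; lra.
have rs0 : 0 <= r1 + r2 by clear -r10 r20; lra.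
have bs : 199 / 100 * (h1 + h2) <= b1 + b2 <= 201 / 100 * (h1 + h2).
  by clear -s11 s12 s21 s22 h11 h21 r10 r20; apply/andP; split; lra.
case/andP: hs => hs0 hs1; case/andP: bs => bs0 bs1.
have S1 : 19 / 10 * (h1 + h2) <= sh (b1 + b2).
  have /andP[+ _] : 99 / 100 * (b1 + b2) <= sh (b1 + b2) <= 101 / 100 * (b1 + b2).
    by apply: sh_bounds; clear -bs0 bs1 hs0 hs1; lra.
  by clear -bs0 hs0; lra.
have [S2 S2'] : 0 <= sh (h1 + h2) /\ sh (h1 + h2) <= 101 / 100 * (h1 + h2).
  have /andP[] : 99 / 100 * (h1 + h2) <= sh (h1 + h2) <= 101 / 100 * (h1 + h2).
    by apply: sh_bounds; clear -hs0 hs1; lra.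
  by clear -hs0 => ? ?; split; lra.
have /andP[T1 _] : 99 / 100 * `|b1 - b2| <= `|sh (b1 - b2)| <= 101 / 100 * `|b1 - b2|.
  apply: sh_abs_bounds; clear -d10 d11 d20 d21 h11 h12 h21 h22 r10 r11 r20 r21.
  by rewrite ler_norml; apply/andP; split; lra.
have /andP[_ T2] : 99 / 100 * `|h1 - h2| <= `|sh (h1 - h2)| <= 101 / 100 * `|h1 - h2|.
  apply: sh_abs_bounds; clear -h11 h12 h21 h22 r10 r11 r20 r21.
  by rewrite ler_norml; apply/andP; split; lra.
have E : sh (b1 + b2) * `|sh (b1 - b2)| <=
         sh (h1 + h2) * `|sh (h1 - h2)| + (r1 + r2) * `|r1 - r2|.
  have S10 : 0 <= sh (b1 + b2) by clear -S1 hs0; lra.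
  rewrite -{1}(ger0_norm S10) -{1}(ger0_norm S2) -{1}(ger0_norm rs0) -!normrM.
  by rewrite /b1 /b2 sh_beta_mul2 ler_normD.
have Lb : `|(b1 - b2) - (h1 - h2)| <= `|b1 - b2| + `|h1 - h2| by exact: ler_normB.
have Lh : 2 * `|h1 - h2| - `|b1 - b2| <= `|2 * (h1 - h2) - (b1 - b2)|.
  by rewrite -{1}(ger0_norm (ler0n R 2)) -normrM lerB_dist.
have Eb : b1 - h1 - (b2 - h2) = (b1 - b2) - (h1 - h2) by clear; ring.
have Eh : 2 * h1 - b1 - (2 * h2 - b2) = 2 * (h1 - h2) - (b1 - b2) by clear; ring.
have dh0 : 0 <= `|h1 - h2| by exact: normr_ge0.
have db0 : 0 <= `|b1 - b2| by exact: normr_ge0.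
have db : `|b1 - b2| <= 9 / 10 * `|h1 - h2|.
  have g1 : (19 / 10 * (h1 + h2)) * (99 / 100 * `|b1 - b2|) <= sh (b1 + b2) * `|sh (b1 - b2)|.
    by apply: ler_pM => //; clear -hs0 db0; lra.
  have g2 : sh (h1 + h2) * `|sh (h1 - h2)| <= (101 / 100 * (h1 + h2)) * (101 / 100 * `|h1 - h2|).
    by apply: ler_pM.
  have g3 : (r1 + r2) * `|r1 - r2| <= (20 / 9 * (h1 + h2)) * (`|h1 - h2| / 4).
    by apply: ler_pM.
  have g4 : 0 <= (h1 + h2) * `|h1 - h2| by apply: mulr_ge0 => //; apply: ltW.
  rewrite -(ler_pM2l hs0); clear -E g1 g2 g3 g4; lra.
split; first by rewrite Eh; clear -Lh db dh0; lra.
have -> : r1 * sh (b1 - h1) - r2 * sh (b2 - h2) =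
  (r1 - r2) * sh (b1 - h1) + r2 * (sh (b1 - h1) - sh (b2 - h2)) by clear; ring.
have g1 : `|(r1 - r2) * sh (b1 - h1)| <= `|h1 - h2| / 4 * (1 / 10).
  by rewrite normrM (ger0_norm D1); apply: ler_pM.
have g2 : `|r2 * (sh (b1 - h1) - sh (b2 - h2))| <= 1 / 100 * (2 * `|h1 - h2|).
  rewrite normrM (ger0_norm (ltW r20)); apply: ler_pM => //; first exact: ltW.
    by clear -r21; lra.
  apply: le_trans (_ : 103 / 100 * `|b1 - h1 - (b2 - h2)| <= _).
    by apply: sh_bound_sub => //; [clear -d11 | clear -d21]; lra.
  by rewrite Eb; clear -Lb db dh0; lra.
by apply: le_trans (ler_normD _ _) _; clear -g1 g2 dh0; lra.
Qed.

End Estimates.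
Lemma continuous_pair (T U V : topologicalType) (f : T -> U) (g : T -> V) (x : T) :
  {for x, continuous f} -> {for x, continuous g} ->
  {for x, continuous (fun t => (f t, g t))}.
Proof. by move=> cf cg; exact: (cvg_pair cf cg). Qed.

(** * Wedge, cylinders of sign sequences, expansion and escape *)

Section Dynamics.
Variable R : realType.
Implicit Types (z w : R * R) (s : nat -> bool).

(** Each of the two formulas is continuous on the whole plane, unlike [step], so closures and paths
    can be carried through it. *)
Definition branch (b : bool) z : R * R :=
  if b then (2 * z.1 - beta z.1 z.2, z.2 * sh (beta z.1 z.2 - z.1))
  else (2 * z.1 + beta z.1 z.2, z.2 * sh (beta z.1 z.2 + z.1)).

(* [step] describes [W]; its value at [z.1 = 0] mirrors [W z = p0] for [z.1 = 2]. *)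
Definition step z : R * R := if z.1 == 0 then (0, 0) else branch (0 < z.1) z.

Definition wedge z := [/\ 0 < z.2, z.2 <= 1 / 100 / 100 & `|z.1| <= 3 * z.2].

(** A set containing every wedge point whose image is again in the wedge; it stays away from the
    axis [h = 0]. *)
Definition strip z :=
  [/\ 0 < z.2, z.2 <= 1 / 100 / 100, 9 / 20 * z.2 <= `|z.1| <= 13 / 20 * z.2 &
      `|2 * `|z.1| - beta `|z.1| z.2| <= 3 / 20 / 100 * z.2].

Definition good z := forall k, wedge (iter k step z).

(** The position is constrained up to time [n] but the signs only before [n]: the last point may lie
    on the axis. *)
Definition cylinder n s : set (R * R) :=
  [set z | (forall k, (k <= n)%N -> wedge (iter k step z)) /\
           (forall k, (k < n)%N -> (0 < (iter k step z).1) = s k)].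

(** The two branches are mirror images under [h -> - h], so estimates for [h >= 0] serve both
    signs. *)
Lemma branch_abs z : z.1 != 0 ->
  branch (0 < z.1) z =
    (Num.sg z.1 * (2 * `|z.1| - beta `|z.1| z.2), z.2 * sh (beta `|z.1| z.2 - `|z.1|)).
Proof.
case: z => h r /=; case: ltrgt0P => // h0 _ /=.
  by rewrite gtr0_sg// mul1r.
by rewrite ltr0_sg// betaN opprK; congr pair; lra.
Qed.

Lemma step_abs z : z.1 != 0 ->
  step z =
    (Num.sg z.1 * (2 * `|z.1| - beta `|z.1| z.2), z.2 * sh (beta `|z.1| z.2 - `|z.1|)).
Proof. by move=> z0; rewrite -branch_abs// /step (negbTE z0). Qed.

Lemma norm_step1 z : z.1 != 0 -> `|(step z).1| = `|2 * `|z.1| - beta `|z.1| z.2|.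
Proof. by move=> z0; rewrite step_abs//= normrM normr_sg z0 mul1r. Qed.

Lemma continuous_branch b : continuous (branch b).
Proof.
move=> z.
have c1 : {for z, continuous (fun t : R * R => t.1)} by exact: cvg_fst.
have c2 : {for z, continuous (fun t : R * R => t.2)} by exact: cvg_snd.
have cb := continuous_beta c1 c2.
have csh (f : R * R -> R) : {for z, continuous f} ->
    {for z, continuous (fun t => sh (f t))}.
  by move=> cf; apply: (continuous_comp cf); exact: continuous_sh.
case: b; rewrite /continuous_at.
  apply: (@continuous_pair _ _ _ (fun t : R * R => 2 * t.1 - beta t.1 t.2)
    (fun t => t.2 * sh (beta t.1 t.2 - t.1))).
  - by apply: cvgB; [apply: cvgMr; exact: c1|exact: cb].
  - by apply: cvgM; [exact: c2|apply: csh; apply: cvgB; [exact: cb|exact: c1]].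
apply: (@continuous_pair _ _ _ (fun t : R * R => 2 * t.1 + beta t.1 t.2)
  (fun t => t.2 * sh (beta t.1 t.2 + t.1))).
- by apply: cvgD; [apply: cvgMr; exact: c1|exact: cb].
- by apply: cvgM; [exact: c2|apply: csh; apply: cvgD; [exact: cb|exact: c1]].
Qed.

Lemma wedge_box z : wedge z -> 0 <= `|z.1| /\ `|z.1| <= 1 / 10 / 100.
Proof. by case=> ? ? ?; rewrite normr_ge0; split=> //; lra. Qed.

Lemma wedge_next z : wedge z -> z.1 != 0 ->
  [/\ z.2 ^+ 2 / 10 <= (step z).2, (step z).2 <= 5 * z.2 ^+ 2,
      0 < (step z).2, (step z).2 <= z.2 / 20 / 100 & `|(step z).1| <= 10 * z.2].
Proof.
move=> wz z0; have [h0 h1] := wedge_box wz; case: wz => r0 r1 hr.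
rewrite norm_step1// step_abs//=.
have [b1 /andP[b2 b3] b4] := wedge_step h0 h1 (ltW r0) r1 hr.
split => //.
  by apply: lt_le_trans b2; rewrite divr_gt0// exprn_gt0.
have bh := beta_ge `|z.1| z.2.
clear -h0 b1 bh hr r0; rewrite ler_norml; apply/andP; split; lra.
Qed.

(** The image has height at most [5 r ^ 2], so the wedge there allows
    [|h'| <= 15 r ^ 2 <= 3 / 2000 r], as [r <= 1 / 10000]. This is the constant in [strip]. *)
Lemma wedge_strip z : wedge z -> wedge (step z) -> strip z.
Proof.
move=> wz [s1 s2 s3].
(* On the axis [step] returns the origin, whose height is not positive. *)
have z0 : z.1 != 0 by apply: contraTneq s1 => z0; rewrite /step z0 eqxx /= ltxx.
have [h0 h1] := wedge_box wz; have [_ n1 _ _ _] := wedge_next wz z0.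
case: wz => r0 r1 hr.
have d : `|2 * `|z.1| - beta `|z.1| z.2| <= 3 / 20 / 100 * z.2.
  rewrite -norm_step1//.
  have : z.2 * z.2 <= z.2 * (1 / 100 / 100) by rewrite ler_wpM2l// ltW.
  by clear -s3 n1; rewrite expr2 in n1 *; lra.
by split=> //; exact: strip_bounds.
Qed.

Lemma strip_neq0 z : strip z -> z.1 != 0.
Proof.
case=> r0 _ /andP[+ _] _; rewrite -normr_gt0; apply: lt_le_trans.
by rewrite mulr_gt0// divr_gt0.
Qed.

Lemma sg_same (a b : R) : (0 < a) = (0 < b) -> a != 0 -> b != 0 -> Num.sg a = Num.sg b.
Proof.
case: (ltrgt0P a) => // a0; case: (ltrgt0P b) => // b0 _ _ _.
  by rewrite !gtr0_sg.
by rewrite !ltr0_sg.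
Qed.

Lemma norm_sub_same_sign (a b : R) : (0 < a) = (0 < b) -> a != 0 -> b != 0 ->
  `|a - b| = `| `|a| - `|b| |.
Proof.
case: (ltrgt0P a) => // a0; case: (ltrgt0P b) => // b0 _ _ _.
by rewrite -opprD normrN.
Qed.

Lemma cone_step_strip z w : strip z -> strip w -> (0 < z.1) = (0 < w.1) ->
  `|z.2 - w.2| <= `|z.1 - w.1| / 4 ->
  `|z.1 - w.1| <= `|(step z).1 - (step w).1| /\
  `|(step z).2 - (step w).2| <= `|(step z).1 - (step w).1| / 4.
Proof.
move=> sz sw szw; have z0 := strip_neq0 sz; have w0 := strip_neq0 sw.
rewrite (norm_sub_same_sign szw z0 w0) (step_abs z0) (step_abs w0) /=.
rewrite (sg_same szw z0 w0) -mulrBr normrM normr_sg w0 mul1r.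
case: sz sw => [? ? ? ?] [? ? ? ?] cone.
have [||||||||| c1 c2] := @cone_step _ `|z.1| z.2 `|w.1| w.2 => //.
by split=> //; apply: le_trans c2 _; rewrite ler_wpM2r.
Qed.

Lemma cylinderS n s z : cylinder n.+1 s z ->
  [/\ strip z, (0 < z.1) = s 0%N & cylinder n (s \o succn) (step z)].
Proof.
move=> [wz sz]; split.
- by apply: wedge_strip; [exact: (wz 0%N)|exact: (wz 1%N)].
- exact: (sz 0%N).
- by split=> k kn; rewrite -iterSr; [exact: wz|exact: sz].
Qed.

Lemma cylinder_cons n s z : wedge z -> (0 < z.1) = s 0%N ->
  cylinder n (s \o succn) (step z) -> cylinder n.+1 s z.
Proof.
by move=> wz sz [h1 h2]; split=> -[|k] // kn; rewrite iterSr; [exact: h1|exact: h2].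
Qed.

(** The difference in [h] does not shrink under [step], whereas the width of the wedge is divided by
    at least 2000 each time. The weaker rate [1 / 4] suffices to beat the [2 ^ n] sign prefixes. *)
Lemma cylinder_close n s z w : cylinder n s z -> cylinder n s w ->
  `|z.2 - w.2| <= `|z.1 - w.1| / 4 ->
  `|z.1 - w.1| <= (1 / 4) ^+ n * (3 * (z.2 + w.2)).
Proof.
elim: n s z w => [|n ih] s z w.
  move=> [/(_ 0%N isT)[_ _ hz] _] [/(_ 0%N isT)[_ _ hw] _] _.
  by rewrite expr0 mul1r mulrDr (le_trans (ler_normB _ _))// lerD.
move=> zc wc cone.
have [sz szs zc'] := cylinderS zc; have [sw sws wc'] := cylinderS wc.
have [|e1 e2] := cone_step_strip sz sw _ cone; first by rewrite szs sws.
have := ih _ _ _ zc' wc' e2.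
have [_ _ _ rz _] := wedge_next (zc.1 0%N isT) (strip_neq0 sz).
have [_ _ _ rw _] := wedge_next (wc.1 0%N isT) (strip_neq0 sw).
rewrite /= in rz rw.
case: sz => z0 _ _ _; case: sw => w0 _ _ _.
move=> h; apply: le_trans e1 _; apply: (le_trans h).
rewrite exprSr -mulrA; apply: ler_wpM2l; first by rewrite exprn_ge0// divr_ge0.
by clear -rz rw z0 w0; lra.
Qed.

Lemma cylinder_eq s z w : (forall n, cylinder n s z) -> (forall n, cylinder n s w) ->
  z.2 = w.2 -> z = w.
Proof.
move=> zc wc e.
have [_ _ _] := (zc 0%N).1 0%N isT.
have h n : `|z.1 - w.1| <= (1 / 4) ^+ n * (3 * (z.2 + w.2)).
  by apply: (cylinder_close (zc n) (wc n)); rewrite e subrr normr0 divr_ge0.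
have : `|z.1 - w.1| <= 0.
  have cv : (fun n => (1 / 4 : R) ^+ n * (3 * (z.2 + w.2))) @ \oo --> (0 : R).
    rewrite -[X in _ --> X](mul0r (3 * (z.2 + w.2))); apply: cvgMl.
    by apply: cvg_expr; rewrite ger0_norm; lra.
  by rewrite -(cvg_lim _ cv)//; apply: limr_ge; [apply/cvg_ex; eexists; exact: cv|exact: nearW].
by rewrite normr_le0 subr_eq0 => /eqP; case: z w e {zc wc h} => ? ? [? ?] /= -> ->.
Qed.

Lemma good_cylinder z n : good z -> cylinder n (fun k => 0 < (iter k step z).1) z.
Proof. by move=> gz; split. Qed.

Lemma cylinder_good s z : (forall n, cylinder n s z) -> good z.
Proof. by move=> h k; apply: (h k).1. Qed.

Lemma good_step z : good z -> good (step z).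
Proof. by move=> gz k; rewrite -iterSr. Qed.

Lemma good_strip z k : good z -> strip (iter k step z).
Proof. by move=> gz; apply: wedge_strip; [exact: gz|exact: (gz k.+1)]. Qed.

Lemma good_iter2_le z k : good z -> (iter k step z).2 <= (1 / 2) ^+ k.
Proof.
move=> gz; elim: k => [|k ih] /=.
  by have [_ + _] := gz 0%N; rewrite expr0 /=; lra.
have [_ _ _ + _] := wedge_next (gz k) (strip_neq0 (good_strip k gz)).
have [+ _ _] := gz k; rewrite exprS => h1 h2; clear -ih h1 h2; lra.
Qed.

Lemma good_cvg z : good z ->
  (fun k => (iter k step z).1) @ \oo --> (0 : R) /\ (fun k => (iter k step z).2) @ \oo --> (0 : R).
Proof.
move=> gz.
have c0 : (fun k => (1 / 2 : R) ^+ k) @ \oo --> (0 : R).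
  by apply: cvg_expr; rewrite ger0_norm; lra.
have c2 : (fun k => (iter k step z).2) @ \oo --> (0 : R).
  apply: (@squeeze_cvgr _ _ _ _ (fun=> 0) (fun k => (1 / 2 : R) ^+ k)) => //; last exact: cvg_cst.
  by apply: nearW => k; rewrite good_iter2_le//; have [/ltW -> _ _] := gz k.
split=> //; apply/norm_cvg0P.
apply: (@squeeze_cvgr _ _ _ _ (fun=> 0) (fun k => 3 * (iter k step z).2)).
- by apply: nearW => k; rewrite normr_ge0; have [_ _ ->] := gz k.
- exact: cvg_cst.
- by rewrite -[X in _ --> X](mulr0 3); apply: cvgMr.
Qed.

(** The conclusion of [escape_step] reproduces its hypotheses. When [|h| > r] this keeps [|h|] away
    from 0 forever; the case [r = 0] is included and settles the axis [y = 0]. *)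
Lemma escape_invariant z k : z.1 != 0 -> `|z.1| <= 1 / 10 / 100 -> 0 <= z.2 ->
  z.2 <= 1 / 100 / 100 -> 3 * z.2 <= `|z.1| ->
  `|z.1| - z.2 <= `|(iter k step z).1|.
Proof.
move=> z0 h1 r0 r1 hr.
suff : [/\ (iter k step z).1 != 0, `|(iter k step z).1| <= 1 / 10 / 100,
    0 <= (iter k step z).2 <= 1 / 100 / 100, 3 * (iter k step z).2 <= `|(iter k step z).1| &
    `|z.1| - z.2 <= `|(iter k step z).1| - (iter k step z).2].
  by move=> [_ _ /andP[? _] _ h]; apply: le_trans h _; rewrite lerBlDr lerDl.
elim: k => [|k [i1 i2 /andP[i3 i4] i5 i6]]; first by split=> //=; rewrite r0.
have i1' : 0 < `|(iter k step z).1| by rewrite normr_gt0.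
have [e1 e2 e3 /andP[e4 e5] e6] := escape_step i1' i2 i3 i4 i5.
rewrite iterS -normr_gt0 norm_step1// step_abs//=.
rewrite (gtr0_norm e1); split=> //.
- exact: le_trans i2.
- by rewrite e4 (le_trans e5).
- exact: le_trans e6.
Qed.

End Dynamics.
Arguments step {R} z.

Lemma closure_image (T U : topologicalType) (f : T -> U) (A : set T) (x : T) :
  {for x, continuous f} -> closure A x -> closure (f @` A) (f x).
Proof.
move=> cf Ax B /cf fB; have [y [Ay fBy]] := Ax _ fB.
by exists (f y); split=> //; exists y.
Qed.

(** * Existence of points with a prescribed sign sequence, and closedness *)

Section Existence.
Variable R : realType.
Implicit Types (z w : R * R) (s : nat -> bool).

(** A closed sector meeting the axis [h = 0] only at the origin, so a limit of strip points of one
    sign keeps that sign if its height is positive. *)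
Definition half (b : bool) : set (R * R) :=
  [set z | 0 <= z.2 /\ z.2 <= 1 / 100 / 100 /\
     9 / 20 * z.2 <= (if b then z.1 else - z.1) /\ (if b then z.1 else - z.1) <= 13 / 20 * z.2].

Lemma closed_half b : closed (half b).
Proof.
have cl (f : R * R -> R) : continuous f -> closed [set z | 0 <= f z].
  by move=> cf; apply: (@preimage_closed _ _ f [set u | 0 <= u]) => //; exact: closed_ge.
have c1 : continuous (fun z : R * R => z.1) by move=> z; exact: cvg_fst.
have c2 : continuous (fun z : R * R => z.2) by move=> z; exact: cvg_snd.
have cs : continuous (fun z : R * R => if b then z.1 else - z.1).
  by case: b => // z; apply: cvgN; exact: c1.
have -> : half b = [set z | 0 <= z.2] `&` [set z | 0 <= 1 / 100 / 100 - z.2] `&`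
   [set z | 0 <= (if b then z.1 else - z.1) - 9 / 20 * z.2] `&`
   [set z | 0 <= 13 / 20 * z.2 - (if b then z.1 else - z.1)].
  apply/seteqP; split=> z /=; rewrite !subr_ge0.
    by move=> [? [? [? ?]]].
  by move=> [[[? ?] ?] ?].
apply: closedI; [apply: closedI; [apply: closedI|]|]; apply: cl => // z.
- by apply: cvgB; [exact: cvg_cst|exact: c2].
- by apply: cvgB; [exact: cs|apply: cvgMr; exact: c2].
- by apply: cvgB; [apply: cvgMr; exact: c2|exact: cs].
Qed.

Lemma strip_half z : strip z -> half (0 < z.1) z.
Proof.
move=> sz; have z0 := strip_neq0 sz; case: sz => r0 r1 + _.
rewrite /half/= (ltW r0) r1; case: (ltrgt0P z.1) z0 => // h0 _ /andP[? ?]; by do !split.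
Qed.

Lemma half_wedge b z : half b z -> 0 < z.2 -> [/\ wedge z, (0 < z.1) = b & z.1 != 0].
Proof.
move=> [_ [r1 [h0 h1]]] r0.
have p : 0 < 9 / 20 * z.2 by clear -r0; lra.
have q := lt_le_trans p h0.
have w : `|z.1| = if b then z.1 else - z.1.
  by case: b q {h0 h1} => q; [rewrite gtr0_norm|rewrite ltr0_norm -?oppr_gt0].
split; first by split=> //; rewrite w (le_trans h1)//; clear -r0; lra.
  by case: b q {h0 h1 w} => // q; apply/negbTE; rewrite -leNgt -oppr_ge0 ltW.
by rewrite -normr_gt0 w.
Qed.

(** Induction on [n] over all paths from the left edge of the wedge to the right one. General paths
    are needed because [step] does not keep horizontal segments horizontal. *)
Lemma path_cylinder n s (f g : R -> R) (a b : R) : a <= b ->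
  continuous f -> continuous g -> (forall t, 0 < g t <= 1 / 100 / 100) ->
  f a <= - (3 * g a) -> 3 * g b <= f b ->
  exists2 t, t \in `[a, b] & cylinder n s (f t, g t).
Proof.
elim: n s f g => [|n ih] s f g ab cf cg gp fa fb.
  have ga : 0 < g a by case/andP: (gp a).
  have gb : 0 < g b by case/andP: (gp b).
  (* With no sign to realize, a point of the path on the axis is enough. *)
  have [||t tab ft] := @IVT _ f a b 0 ab.
  - exact: continuous_subspaceT.
  - by rewrite minElt maxElt; have fab : f a < f b; [clear -fa fb ga gb; lra|];
      rewrite fab; clear -fa fb ga gb; apply/andP; split; lra.
  exists t => //; split=> [[|//] _|//]; have /andP[? ?] := gp t.
  by split=> //=; rewrite ft normr0 mulr_ge0// ltW.
(* The clamped path [F] agrees with [f] at the points that will be found, because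
   their slopes lie strictly between the clamping bounds. *)
pose c := if s 0%N then 3 / 10 else - 3 : R.
pose d := if s 0%N then 3 else - (3 / 10) : R.
pose F t := Num.max (c * g t) (Num.min (d * g t) (f t)).
have cF : continuous F.
  have cm (k : R) : continuous (fun t => k * g t) by move=> t; apply: cvgMr; exact: cg.
  apply: (@max_fun_continuous _ _ _ (fun t => c * g t) (fun t => Num.min (d * g t) (f t))) => //.
  exact: (@min_fun_continuous _ _ _ (fun t => d * g t) f).
have cdg t : c * g t < d * g t.
  by have /andP[gt0 _] := gp t; rewrite ltr_pM2r// /c /d; case: (s 0%N); lra.
have Fb t : c * g t <= F t <= d * g t.
  by rewrite /F le_max lexx/= ge_max (ltW (cdg t))/= ge_min lexx.
have FE t : c * g t < F t -> F t < d * g t -> F t = f t.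
  rewrite /F minElt maxElt; case: (ltP (d * g t) (f t)) => h1.
    by case: (ltP (c * g t) (d * g t)) => h2; rewrite ltxx.
  by case: (ltP (c * g t) (f t)) => h2; rewrite ?ltxx.
have Fabs t : 3 / 10 * g t <= `|F t| /\ `|F t| <= 3 * g t /\ (0 < F t) = s 0%N.
  have /andP[gt0 _] := gp t; have := Fb t; rewrite /c /d.
  case: (s 0%N) => /andP[F1 F2].
    have F0 : 0 < F t by clear -F1 gt0; lra.
    by rewrite F0 gtr0_norm//; split.
  have F0 : F t < 0 by clear -F2 gt0; lra.
  rewrite ltr0_norm//; split; [|split]; [clear -F2; lra|clear -F1; lra|].
  by apply/negbTE; rewrite -leNgt ltW.
have Fw t : wedge (F t, g t).
  by have /andP[? ?] := gp t; have [_ [? _]] := Fabs t; split.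
have F0 t : F t != 0.
  have /andP[gt0 _] := gp t; have [h _] := Fabs t; rewrite -normr_gt0.
  by apply: lt_le_trans h; clear -gt0; lra.
pose f' t := (branch (s 0%N) (F t, g t)).1; pose g' t := (branch (s 0%N) (F t, g t)).2.
have stepE t : step (F t, g t) = (f' t, g' t).
  have [_ [_ sF]] := Fabs t.
  by rewrite /step/= (negbTE (F0 t)) sF /f' /g'; case: (branch _ _).
have cb : continuous (fun t => branch (s 0%N) (F t, g t)).
  move=> t; apply: (@continuous_comp _ _ _ (fun t => (F t, g t))); last exact: continuous_branch.
  by apply: continuous_pair; [exact: cF|exact: cg].
have g'E t : g' t = (step (F t, g t)).2 by rewrite stepE.
have nx t : 0 < g' t /\ g' t <= g t / 20 / 100.
  by rewrite g'E; have [_ _ ? ? _] := wedge_next (Fw t) (F0 t).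
(* The outer edge of the clamped range escapes outwards under [step], the inner
   edge is thrown across the axis, so the image path again crosses the wedge. *)
have outer t : `|F t| = 3 * g t -> 3 * g' t <= 2 * `|F t| - beta `|F t| (g t).
  move=> e; have /andP[gt0 gt1] := gp t.
  have Fp : 0 < `|F t| by rewrite normr_gt0 F0.
  have [_ F1] := wedge_box (Fw t).
  have [|_ _ + _ _] := escape_step Fp F1 (ltW gt0) gt1; first by rewrite e.
  by rewrite g'E step_abs ?F0.
have inner t : `|F t| = 3 / 10 * g t -> 2 * `|F t| - beta `|F t| (g t) <= - (3 * g' t).
  move=> e; have /andP[gt0 gt1] := gp t; have [_ F1] := wedge_box (Fw t).
  have := inner_step (normr_ge0 (F t)) F1 gt0 gt1; rewrite e lexx => /(_ isT) h.
  by apply: le_trans h _; have [_ h] := nx t; clear -h gt0; lra.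
have f'E t : f' t = Num.sg (F t) * (2 * `|F t| - beta `|F t| (g t)).
  by have := stepE t; rewrite step_abs ?F0//= => -[<- _].
have [|||||t tab] := ih (s \o succn) f' g' ab.
- move=> t; apply: (@continuous_comp _ _ _ (fun t => branch (s 0%N) (F t, g t))
    (fun z : R * R => z.1)); [exact: cb|exact: cvg_fst].
- move=> t; apply: (@continuous_comp _ _ _ (fun t => branch (s 0%N) (F t, g t))
    (fun z : R * R => z.2)); [exact: cb|exact: cvg_snd].
- move=> t; have [-> h] := nx t; have /andP[gt0 gt1] := gp t.
  by rewrite /=; clear -h gt0 gt1; lra.
(* At [a] the lower clamp is active: it is the inner edge for a positive sign and the outer edge for
   a negative one. The sign factor of the image sends both beyond the left edge; at [b] the roles
   are exchanged. *)
- have /andP[ga0 _] := gp a; have FaE : F a = c * g a.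
    rewrite /F; apply/max_idPl; rewrite ge_min; apply/orP; right.
    by apply: le_trans fa _; rewrite /c; case: (s 0%N); clear -ga0; lra.
  rewrite f'E; have [_ [_]] := Fabs a; move: FaE; rewrite /c; case: (s 0%N) => FaE Fs.
    by rewrite gtr0_sg// mul1r; apply: inner; rewrite gtr0_norm.
  have Fn : F a < 0 by rewrite FaE; clear -ga0; lra.
  rewrite ltr0_sg// mulN1r lerN2; apply: outer.
  by rewrite ltr0_norm// FaE mulNr opprK.
- have /andP[gb0 _] := gp b; have FbE : F b = d * g b.
    rewrite /F minElt; case: ltP => [_|h].
      by apply/max_idPr; rewrite ltW.
    have -> : f b = d * g b.
      apply/eqP; rewrite eq_le h/=; apply: le_trans fb.
      by rewrite /d; case: (s 0%N); clear -gb0; lra.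
    by apply/max_idPr; rewrite ltW.
  rewrite f'E; have [_ [_]] := Fabs b; move: FbE; rewrite /d; case: (s 0%N) => FbE Fs.
    by rewrite gtr0_sg// mul1r; apply: outer; rewrite gtr0_norm.
  have Fn : F b < 0 by rewrite FbE; clear -gb0; lra.
  rewrite ltr0_sg// mulN1r lerNr; apply: inner.
  by rewrite ltr0_norm// FbE mulNr opprK.
rewrite -stepE => tc.
exists t => //; have /andP[gt0 gt1] := gp t.
(* The image is in the wedge, so the slope lies between [9 / 20] and [13 / 20], strictly inside the
   clamping range from [3 / 10] to [3]. *)
have [_ _ /andP[s1 s2] _] := wedge_strip (Fw t) (tc.1 0%N isT).
have [_ [_ sF]] := Fabs t.
have <- : F t = f t.
  rewrite /= in s1 s2; apply: FE; move: sF; rewrite /c /d; case: (s 0%N) => sF;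
    move: s1 s2; rewrite ?(gtr0_norm sF) ?ltr0_norm;
    try (by rewrite lt_neqAle F0 leNgt sF); clear -gt0; move=> *; lra.
by apply: cylinder_cons.
Qed.

(** Cylinders are not closed and [step] jumps on the axis. Limits of points of [cylinder 1 s] lie in
    one closed [half], and there the corresponding continuous branch carries closures to
    closures. *)
Lemma closure_cylinder_step s z : (forall n, closure (cylinder n s) z) -> 0 < z.2 ->
  [/\ wedge z, (0 < z.1) = s 0%N, (forall n, closure (cylinder n (s \o succn)) (step z)) &
      0 < (step z).2].
Proof.
move=> cz z0.
have /half_wedge/(_ z0)[wz sz zn0] : half (s 0%N) z.
  apply: (closed_half (b := s 0%N)); apply: closureS (cz 1%N) => w wc.
  by have [/strip_half + <- _] := cylinderS wc.
split=> //; last by have [_ _ ? _ _] := wedge_next wz zn0.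
move=> n; rewrite /step (negbTE zn0) sz.
apply: closureS (closure_image (@continuous_branch _ (s 0%N) z) (cz n.+1)).
move=> _ [w wc <-]; have [sw <- wc'] := cylinderS wc.
by move: wc'; rewrite /step (negbTE (strip_neq0 sw)).
Qed.

Lemma closure_cylinder s z : (forall n, closure (cylinder n s) z) -> 0 < z.2 ->
  forall n, cylinder n s z.
Proof.
move=> cz z0 n; elim: n s z cz z0 => [|n ih] s z cz z0;
  have [wz sz cz' z0'] := closure_cylinder_step cz z0.
  by split=> // -[].
by apply: cylinder_cons => //; exact: ih.
Qed.

(** Compactness: [path_cylinder] on the horizontal segment at height [r] gives a point for each [n].
    The cylinders decrease, so a cluster point lies in the closure of all of them, and
    [closure_cylinder] applies. *)
Lemma cylinder_exists s (r : R) : 0 < r -> r <= 1 / 100 / 100 ->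
  exists h, forall n, cylinder n s (h, r).
Proof.
move=> r0 r1.
have r3 : - (3 * r) <= 3 * r by clear -r0; lra.
have /choice[u uP] : forall n, exists t, t \in `[- (3 * r), 3 * r] /\ cylinder n s (t, r).
  move=> n; have [||||| t t1 t2] := @path_cylinder n s id (fun=> r) _ _ r3.
  - by move=> t; exact: cvg_id.
  - by move=> t; exact: cvg_cst.
  - by move=> _; rewrite r0 r1.
  - exact: lexx.
  - exact: lexx.
  by exists t.
have uS : (u @ \oo) `[- (3 * r), 3 * r]%classic.
  by exists 0%N => // n _ /=; have [] := uP n.
have [h [_ hc]] := @segment_compact R (- (3 * r)) (3 * r) (u @ \oo) _ uS.
exists h; apply: closure_cylinder => // n.
have ch : {for h, continuous (fun t : R => (t, r))}.
  by apply: continuous_pair; [exact: cvg_id|exact: cvg_cst].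
have hu : closure (u @` [set m | (n <= m)%N]) h.
  by move=> B hB; apply: hc hB; exists n => // m nm; exists m.
apply: closureS (closure_image ch hu).
move=> _ [_ [m nm <-] <-]; have [_ [c1 c2]] := uP m.
by split=> k kn; [apply: c1 | apply: c2]; [exact: leq_trans nm|exact: leq_trans nm].
Qed.

(** No sign is prescribed here, but the closure of a union of two sets is the union of the closures,
    so the limit is approached from within one half. *)
Lemma closure_good_step z : closure (@good R) z -> 0 < z.2 ->
  [/\ wedge z, closure (@good R) (step z) & 0 < (step z).2].
Proof.
move=> cz z0.
have [b hb] : exists b, closure (@good R `&` half b) z.
  apply: contrapT => /forallNP nb; have := cz.
  have -> : @good R = (@good R `&` half true) `|` (@good R `&` half false).
    apply/seteqP; split=> w; last by case=> -[].
    by move=> gw; have := strip_half (good_strip 0 gw); case: (0 < _); [left|right].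
  by rewrite closureU => -[/nb|/nb].
have hz : half b z by apply: closed_half; apply: closureS hb => w [].
have [wz sz zn0] := half_wedge hz z0.
split=> //; last by have [_ _ ? _ _] := wedge_next wz zn0.
rewrite /step (negbTE zn0) sz.
apply: closureS (closure_image (@continuous_branch _ b z) hb).
move=> _ [w [gw hw] <-].
have w0 : 0 < w.2 by have [] := gw 0%N.
have [_ ws _] := half_wedge hw w0.
by move: (good_step gw); rewrite /step (negbTE (strip_neq0 (good_strip 0 gw))) ws.
Qed.

Lemma closure_good z : closure (@good R) z -> 0 < z.2 -> good z.
Proof.
move=> cz z0 k.
suff : closure (@good R) (iter k step z) /\ 0 < (iter k step z).2.
  by move=> [h1 h2]; have [] := closure_good_step h1 h2.
elim: k => [|k [h1 h2]] //=.
by have [] := closure_good_step h1 h2.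
Qed.

End Existence.

(** * Conjugation of [W] to [step] *)

Section Coordinates.
Variable R : realType.
Implicit Types (x y h r b : R) (z : R * R).

Definition chart z : R * R := (ln (z.1 / 2) / 2, `|z.2| * Num.sqrt z.1).

Definition unchart z : R * R :=
  (2 * expR (2 * z.1), z.2 / Num.sqrt (2 * expR (2 * z.1))).

Lemma unchartK z : 0 <= z.2 -> chart (unchart z) = z.
Proof.
case: z => h r /= r0; have e0 := expR_gt0 (2 * h).
have p0 : 0 < 2 * expR (2 * h) by rewrite mulr_gt0.
rewrite /chart /unchart/=; congr pair.
  by rewrite [2 * expR _]mulrC mulfK// expRK [2 * h]mulrC mulfK.
by rewrite ger0_norm ?divr_ge0 ?sqrtr_ge0// divfK// gt_eqF// sqrtr_gt0.
Qed.

Lemma chartK z : 0 < z.1 -> 0 <= z.2 -> unchart (chart z) = z.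
Proof.
case: z => x y /= x0 y0; rewrite /unchart/=.
have -> : 2 * expR (2 * (ln (x / 2) / 2)) = x.
  by rewrite [2 * (_ / 2)]mulrC divfK// lnK ?posrE ?divr_gt0// mulrC divfK.
by rewrite ger0_norm// mulfK// gt_eqF// sqrtr_gt0.
Qed.

Lemma chart1_expR z : 0 < z.1 -> z.1 = 2 * expR (chart z).1 ^+ 2.
Proof.
move=> x0; rewrite -expRM_natl /= [2 * (_ / 2)]mulrC divfK// lnK ?posrE ?divr_gt0//.
by rewrite mulrC divfK.
Qed.

Lemma chart2_sqr z : 0 < z.1 -> (chart z).2 ^+ 2 = z.1 * z.2 ^+ 2.
Proof. by move=> x0; rewrite /= exprMn real_normK ?num_real// sqr_sqrtr ?ltW// mulrC. Qed.

(** [omega_p] and [omega_m] are the roots of this quadratic and [Delta] is its discriminant. A root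
    is therefore identified by the equation and its sign. *)
Lemma omega_quadratic x y w :
  r1sq x y * w ^+ 2 - (x ^+ 2 - 4) * w - 4 * x ^+ 2 * y ^+ 2 = 0 ->
  (2 * r1sq x y * w - (x ^+ 2 - 4)) ^+ 2 = Delta x y.
Proof.
move=> q.
have -> : Delta x y = (x ^+ 2 - 4) ^+ 2 + 16 * x ^+ 2 * y ^+ 2 * r1sq x y.
  by rewrite /Delta /r1sq; ring.
have -> : (2 * r1sq x y * w - (x ^+ 2 - 4)) ^+ 2 = 4 * r1sq x y *
    (r1sq x y * w ^+ 2 - (x ^+ 2 - 4) * w - 4 * x ^+ 2 * y ^+ 2) +
    ((x ^+ 2 - 4) ^+ 2 + 16 * x ^+ 2 * y ^+ 2 * r1sq x y) by ring.
by rewrite q mulr0 add0r.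
Qed.

Lemma r1sq_gt0 x y : 0 < r1sq x y.
Proof.
rewrite /r1sq; have := sqr_ge0 x; have := mulr_ge0 (sqr_ge0 x) (sqr_ge0 y); lra.
Qed.

Lemma omega_pE x y w : 0 < x -> x <= 2 -> 0 <= w ->
  r1sq x y * w ^+ 2 - (x ^+ 2 - 4) * w - 4 * x ^+ 2 * y ^+ 2 = 0 ->
  omega_p x y = w.
Proof.
move=> x0 x2 w0 q; have r0 := r1sq_gt0 x y.
have xx : x ^+ 2 <= 4.
  have : x * x <= 2 * 2 by apply: ler_pM => //; exact: ltW.
  by rewrite expr2; clear; lra.
have s0 : 0 <= 2 * r1sq x y * w - (x ^+ 2 - 4).
  have : 0 <= r1sq x y * w by rewrite mulr_ge0// ltW.
  by clear -xx; lra.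
rewrite /omega_p -(omega_quadratic q) sqrtr_sqr ger0_norm//.
by field; rewrite gt_eqF.
Qed.

Lemma omega_mE x y w : 2 <= x -> w <= 0 ->
  r1sq x y * w ^+ 2 - (x ^+ 2 - 4) * w - 4 * x ^+ 2 * y ^+ 2 = 0 ->
  omega_m x y = w.
Proof.
move=> x2 w0 q; have r0 := r1sq_gt0 x y.
have xx : 4 <= x ^+ 2.
  have : 2 * 2 <= x * x by apply: ler_pM.
  by rewrite expr2; clear; lra.
have s0 : 2 * r1sq x y * w - (x ^+ 2 - 4) <= 0.
  have : 0 <= r1sq x y * - w by rewrite mulr_ge0 ?oppr_ge0// ltW.
  by clear -xx; lra.
rewrite /omega_m -(omega_quadratic q) sqrtr_sqr ler0_norm//.
by field; rewrite gt_eqF.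
Qed.

(** With [E = expR h] and [B = expR b] the hypothesis is [sinh b ^ 2 = sinh h ^ 2 + r ^ 2], since
    [r ^ 2 = x y ^ 2], and [w] is [tanh (h + b)]. *)
Lemma omega_quadratic_param (E B y : R) : 0 < E -> 0 < B ->
  ((B - B^-1) / 2) ^+ 2 = ((E - E^-1) / 2) ^+ 2 + 2 * E ^+ 2 * y ^+ 2 ->
  let x := 2 * E ^+ 2 in let w := ((E * B) ^+ 2 - 1) / ((E * B) ^+ 2 + 1) in
  r1sq x y * w ^+ 2 - (x ^+ 2 - 4) * w - 4 * x ^+ 2 * y ^+ 2 = 0.
Proof.
move=> E0 B0 rel x w.
have rel' : E ^+ 2 * (B ^+ 2 - 1) ^+ 2 - B ^+ 2 * (E ^+ 2 - 1) ^+ 2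
    - 8 * E ^+ 4 * B ^+ 2 * y ^+ 2 = 0.
  have -> : E ^+ 2 * (B ^+ 2 - 1) ^+ 2 = 4 * E ^+ 2 * B ^+ 2 * ((B - B^-1) / 2) ^+ 2.
    by field; rewrite gt_eqF.
  by rewrite rel; field; rewrite gt_eqF.
have EB : 0 < (E * B) ^+ 2 by rewrite exprn_gt0// mulr_gt0.
(* The quadratic is a multiple of the relation cleared of denominators. *)
transitivity (8 * E ^+ 2 / ((E * B) ^+ 2 + 1) ^+ 2 *
  (E ^+ 2 * (B ^+ 2 - 1) ^+ 2 - B ^+ 2 * (E ^+ 2 - 1) ^+ 2
    - 8 * E ^+ 4 * B ^+ 2 * y ^+ 2)); last by rewrite rel' mulr0.
by rewrite /w /x /r1sq; field; rewrite gt_eqF// addr_gt0.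
Qed.

(** The hyperbolic tangent. *)
Definition omega_of t : R := (expR t ^+ 2 - 1) / (expR t ^+ 2 + 1).

(* [b] is [beta] or [- beta]; in these coordinates [omega = tanh (h + b)]. *)
Lemma omega_of_root z b : 0 < z.1 ->
  sh b ^+ 2 = sh (chart z).1 ^+ 2 + (chart z).2 ^+ 2 ->
  r1sq z.1 z.2 * omega_of ((chart z).1 + b) ^+ 2
    - (z.1 ^+ 2 - 4) * omega_of ((chart z).1 + b) - 4 * z.1 ^+ 2 * z.2 ^+ 2 = 0.
Proof.
move=> x0; rewrite chart2_sqr// /omega_of expRD !shE !expRN.
have e1 := expR_gt0 (chart z).1; have e2 := expR_gt0 b.
rewrite (chart1_expR x0); move: (expR (chart z).1) (expR b) e1 e2 => E B E0 B0.
exact: omega_quadratic_param.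
Qed.

Lemma omega_of_ge0 t : 0 <= t -> 0 <= omega_of t.
Proof.
move=> t0; have e1 : 1 <= expR t by rewrite -expR0 ler_expR.
have e2 : 1 <= expR t ^+ 2 by rewrite exprn_ege1.
by rewrite /omega_of divr_ge0//; clear -e2; lra.
Qed.

Lemma omega_of_le0 t : t <= 0 -> omega_of t <= 0.
Proof.
move=> t0; have e1 : expR t <= 1 by rewrite -expR0 ler_expR.
have e2 : expR t ^+ 2 <= 1 by rewrite exprn_ile1// expR_ge0.
have e3 : 0 <= expR t ^+ 2 by rewrite exprn_ge0// expR_ge0.
by rewrite /omega_of mulr_le0_ge0 ?invr_ge0//; clear -e2 e3; lra.
Qed.

(** For [w = tanh t] the two multipliers are [expR t ^ 2] and [|sinh t| / expR t]. The first
    translates [h] by [t] and scales [sqrt x] by [expR t], which cancels the denominator of the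
    second. *)
Lemma chart_image z t : 0 < z.1 ->
  let w := omega_of t in
  let z' := ((1 + w) / (1 - w) * z.1, `|w| / (1 + w) * z.2) in
  chart z' = ((chart z).1 + t, (chart z).2 * `|sh t|) /\ 0 < z'.1.
Proof.
move=> x0 w z'.
have T0 := expR_gt0 t; set T := expR t in T0.
have TT : 0 < T ^+ 2 + 1 by rewrite addr_gt0// exprn_gt0.
have w1 : 1 + w = 2 * T ^+ 2 / (T ^+ 2 + 1).
  by rewrite /w /omega_of -/T; field; rewrite gt_eqF.
have w2 : 1 - w = 2 / (T ^+ 2 + 1) by rewrite /w /omega_of -/T; field; rewrite gt_eqF.
have qE : (1 + w) / (1 - w) = T ^+ 2 by rewrite w1 w2; field; rewrite gt_eqF.
have wE : `|w| / (1 + w) = `|sh t| / T.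
  have -> : sh t = w * ((T ^+ 2 + 1) / (2 * T)).
    by rewrite shE expRN -/T /w /omega_of -/T; field; rewrite !gt_eqF.
  have c0 : 0 <= (T ^+ 2 + 1) / (2 * T) by rewrite divr_ge0// ltW// mulr_gt0.
  rewrite (normrM w) (ger0_norm c0).
  by rewrite w1; field; rewrite !gt_eqF.
have x'0 : 0 < T ^+ 2 * z.1 by rewrite mulr_gt0// exprn_gt0.
split; last by rewrite /z'/= qE.
rewrite /chart /z' /= qE wE; congr pair.
  rewrite -mulrA lnM ?posrE ?exprn_gt0 ?divr_gt0// lnXn// expRK.
  by rewrite mulr2n; clear; lra.
rewrite normrM normrM normr_id normfV (gtr0_norm T0) sqrtrM ?exprn_ge0 ?ltW//.
by rewrite sqrtr_sqr (gtr0_norm T0); field; rewrite gt_eqF.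
Qed.

Lemma chart1_gt0 z : 0 < z.1 -> (0 < (chart z).1) = (2 < z.1).
Proof.
by move=> x0; rewrite /= pmulr_lgt0// -ln1 ltr_ln ?posrE ?divr_gt0// ltr_pdivlMr// mul1r.
Qed.

Lemma chart1_lt0 z : 0 < z.1 -> ((chart z).1 < 0) = (z.1 < 2).
Proof.
by move=> x0; rewrite /= pmulr_llt0// -ln1 ltr_ln ?posrE ?divr_gt0// ltr_pdivrMr// mul1r.
Qed.

(** [omega = tanh t] with [t = h - b] for [x > 2] and [t = h + b] for [x < 2]; the sign of [t],
    known from [b >= |h|], picks the root. *)
Lemma chart_W z : 0 < z.1 -> chart (W z) = step (chart z) /\ 0 < (W z).1.
Proof.
move=> x0; set h := (chart z).1; set r := (chart z).2.
have c1 := chart1_gt0 x0; have c2 := chart1_lt0 x0; rewrite -/h in c1 c2.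
have sE := sqr_sh_beta h r.
rewrite /W -c1 -c2 /step -/h /branch -/r; case: (ltrgt0P h) => h0.
- have sE' : sh (- beta h r) ^+ 2 = sh h ^+ 2 + r ^+ 2 by rewrite shN sqrrN.
  have hb : h - beta h r <= 0 by rewrite subr_le0 beta_ge.
  rewrite /W_m; have -> : omega_m z.1 z.2 = omega_of (h - beta h r).
    apply: omega_mE; [by rewrite ltW// -c1|exact: omega_of_le0|exact: omega_of_root].
  have [-> ?] := chart_image (h - beta h r) x0; split=> //.
  rewrite -/h -/r -normrN -shN opprB ger0_norm ?sh_ge0 ?subr_ge0 ?beta_ge//.
  by congr pair; clear; lra.
- have hb : 0 <= h + beta h r by rewrite -lerBlDl sub0r -betaN beta_ge.
  rewrite /W_p; have -> : omega_p z.1 z.2 = omega_of (h + beta h r).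
    apply: omega_pE => //; [by rewrite ltW// -c2|exact: omega_of_ge0|exact: omega_of_root].
  have [-> ?] := chart_image (h + beta h r) x0; split=> //.
  rewrite -/h -/r ger0_norm ?sh_ge0// [beta h r + h]addrC.
  by congr pair; clear; lra.
(* On the line [x = 2] the default values agree: [W] gives [p0], whose chart is the origin. *)
- by rewrite /chart /p0/= divff// ln1 mul0r normr0 mul0r.
Qed.

Lemma chart_Worbit z k : 0 < z.1 ->
  chart (Worbit z k) = iter k step (chart z) /\ 0 < (Worbit z k).1.
Proof.
move=> x0; elim: k => [|k [ih1 ih2]] //=.
by have [e ?] := chart_W ih2; rewrite e ih1.
Qed.

End Coordinates.

(** * The neighborhood of [p0] and the stable set in it *)

Section StableSet.
Variable R : realType.
Implicit Types (z : R * R).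

(** A box in the chart. Its bound on [h] is ten times that on [r] because a wedge point of height
    [r] has an image with [|h'| <= 10 r]. *)
Definition nbhd : set (R * R) :=
  [set z | [/\ 0 < z.1, `|(chart z).1| < 1 / 10 / 100 & (chart z).2 < 1 / 100 / 100]].

Lemma chart_p0 : chart (@p0 R) = (0, 0).
Proof. by rewrite /chart /p0/= divff// ln1 mul0r normr0 mul0r. Qed.

Lemma chart2_ge0 z : 0 <= (chart z).2.
Proof. by rewrite mulr_ge0// sqrtr_ge0. Qed.

Lemma chart2_gt0 z : 0 < z.1 -> (0 < (chart z).2) = (z.2 != 0).
Proof. by move=> x0; rewrite /= pmulr_lgt0 ?sqrtr_gt0// normr_gt0. Qed.

Lemma chart1_eq0 z : 0 < z.1 -> ((chart z).1 == 0) = (z.1 == 2).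
Proof.
move=> x0; have := chart1_gt0 x0; have := chart1_lt0 x0.
by case: (ltrgt0P (chart z).1); case: (ltrgtP z.1 2).
Qed.

Lemma chart_eq0 z : 0 < z.1 -> (chart z).1 = 0 -> (chart z).2 = 0 -> z = p0 R.
Proof.
move=> x0 /eqP; rewrite chart1_eq0// => /eqP x2 r0.
have : ~~ (0 < (chart z).2) by rewrite r0 ltxx.
by rewrite chart2_gt0// negbK => /eqP y0; case: z x2 y0 {x0 r0} => ? ? /= -> ->.
Qed.

Lemma chart_box z : 0 < z.1 -> `|(chart z).1| <= 1 / 10 / 100 -> 1 <= z.1 <= 3.
Proof.
move=> x0; rewrite (chart1_expR x0); set h := (chart z).1; rewrite ler_norml => /andP[h1 h2].
have e1 := expR_ge1Dx h; have e2 := expR_ge1Dx (- h).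
have e3 : expR h * expR (- h) = 1 by rewrite -expRD subrr expR0.
have p1 := expR_gt0 h.
move: (expR h) (expR (- h)) e1 e2 e3 p1 => a b e1 e2 e3 p1.
have a1 : 99 / 100 <= a by clear -e1 h1; lra.
have a2 : a * (99 / 100) <= 1.
  by rewrite -[leRHS]e3 (ler_wpM2l (ltW p1))//; apply: le_trans e2; clear -h2; lra.
have q1 : (99 / 100) * (99 / 100) <= a * a by apply: ler_pM => //; clear; lra.
have q2 : a * a <= (102 / 100) * (102 / 100).
  by apply: ler_pM; [exact: ltW|exact: ltW|clear -a2; lra|clear -a2; lra].
by rewrite expr2; clear -q1 q2; apply/andP; split; lra.
Qed.

Lemma chart2_bounds z : 0 < z.1 -> `|(chart z).1| <= 1 / 10 / 100 ->
  (chart z).2 / 2 <= `|z.2| <= (chart z).2.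
Proof.
move=> x0 /(chart_box x0)/andP[x1 x3].
have s1 : 1 <= Num.sqrt z.1 by rewrite -[leLHS]sqrtr1 ler_wsqrtr.
have s2 : Num.sqrt z.1 <= 2.
  have -> : 2 = Num.sqrt (2 ^+ 2) :> R by rewrite sqrtr_sqr ger0_norm.
  by rewrite ler_wsqrtr//; clear -x3; rewrite expr2; lra.
rewrite /= ler_peMr// andbT ler_pdivrMr//.
by rewrite ler_wpM2l.
Qed.

Lemma continuous_chart z : 0 < z.1 -> {for z, continuous (@chart R)}.
Proof.
move=> x0.
have c1 : {for z, continuous (fun t : R * R => t.1)} by exact: cvg_fst.
have c2 : {for z, continuous (fun t : R * R => t.2)} by exact: cvg_snd.
apply: (@continuous_pair _ _ _ (fun t : R * R => ln (t.1 / 2) / 2)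
  (fun t => `|t.2| * Num.sqrt t.1)).
  apply: cvgMl; apply: (@continuous_comp _ _ _ (fun t : R * R => t.1 / 2) (@ln R)).
    by apply: cvgMl; exact: c1.
  by apply: continuous_ln; rewrite divr_gt0.
apply: cvgM; first by apply: cvg_norm; exact: c2.
by apply: (@continuous_comp _ _ _ (fun t : R * R => t.1) (@Num.sqrt R));
  [exact: c1|exact: sqrt_continuous].
Qed.

Lemma continuous_unchart : continuous (@unchart R).
Proof.
move=> z.
have c1 : {for z, continuous (fun t : R * R => t.1)} by exact: cvg_fst.
have c2 : {for z, continuous (fun t : R * R => t.2)} by exact: cvg_snd.
have cx : {for z, continuous (fun t : R * R => 2 * expR (2 * t.1))}.
  apply: cvgMr; apply: (@continuous_comp _ _ _ (fun t : R * R => 2 * t.1) (@expR R)).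
    by apply: cvgMr; exact: c1.
  exact: continuous_expR.
apply: (@continuous_pair _ _ _ (fun t : R * R => 2 * expR (2 * t.1))
  (fun t => t.2 / Num.sqrt (2 * expR (2 * t.1)))); first exact: cx.
apply: cvgM; first exact: c2.
apply: cvgV; first by rewrite gt_eqF// sqrtr_gt0 mulr_gt0// expR_gt0.
by apply: (@continuous_comp _ _ _ (fun t : R * R => 2 * expR (2 * t.1)) (@Num.sqrt R));
  [exact: cx|exact: sqrt_continuous].
Qed.

Lemma nbhd_open : open nbhd.
Proof.
rewrite openE => z [x0 h r]; rewrite /interior.
have cc := continuous_chart x0.
have c1 : {for z, continuous (fun t => `|(chart t).1|)}.
  apply: cvg_norm.
  by apply: (@continuous_comp _ _ _ (@chart R) (fun t : R * R => t.1)); [exact: cc|exact: cvg_fst].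
have c2 : {for z, continuous (fun t => (chart t).2)}.
  by apply: (@continuous_comp _ _ _ (@chart R) (fun t : R * R => t.2)); [exact: cc|exact: cvg_snd].
have c0 : {for z, continuous (fun t : R * R => t.1)} by exact: cvg_fst.
by near=> w; split; near: w; [exact: cvgr_gt c0 _ x0|exact: cvgr_lt c1 _ h|exact: cvgr_lt c2 _ r].
Unshelve. all: by end_near. Qed.

Lemma nbhd_p0 : nbhd (p0 R).
Proof. by split; rewrite ?chart_p0/= ?normr0 ?divr_gt0. Qed.

Lemma nbhd_regionR : nbhd `<=` regionR (R := R).
Proof.
move=> z [x0 h r]; split=> //.
have /andP[x1 x3] := chart_box x0 (ltW h).
have e := chart2_sqr x0.
have r0 := chart2_ge0 z.
have rr : (chart z).2 ^+ 2 <= 1 / 100.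
  have : (chart z).2 * (chart z).2 <= (1 / 100 / 100) * (1 / 100 / 100).
    by apply: ler_pM => //; exact: ltW.
  by rewrite expr2; clear; lra.
rewrite e in rr; move: z.1 z.2 x1 x3 rr {e r0 r h x0} => x y x1 x3 rr.
have -> : x ^+ 2 * y ^+ 2 = x * (x * y ^+ 2) by ring.
have -> : 8 * x ^+ 2 * y ^+ 4 = 8 * (x * y ^+ 2) ^+ 2 by ring.
have v0 : 0 <= y ^+ 2 by exact: sqr_ge0.
have v1 : 1 * y ^+ 2 <= x * y ^+ 2 by rewrite ler_wpM2r.
set v := x * y ^+ 2 in rr v1 *.
have u0 : 0 <= v by clear -v0 v1; lra.
have u1 : x * v <= 3 * (1 / 100) by apply: ler_pM => //; clear -x1; lra.
have u2 : v * v <= 1 / 100 * (1 / 100) by apply: ler_pM.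
by rewrite (expr2 v); clear -v1 u1 u2 rr; lra.
Qed.

Lemma W_p0 : W (p0 R) = p0 R.
Proof. by rewrite /W /= ltxx. Qed.

(** The wedge at times after 0 is far inside the box, and strip points have [h] nonzero, so the
    orbit avoids the line [x = 2]. *)
Lemma good_chart_nbhd z k : nbhd z -> good (chart z) ->
  nbhd (Worbit z k) /\ domW (Worbit z k).
Proof.
move=> [x0 h r] gz; have [e xk] := chart_Worbit k x0.
have nk : nbhd (Worbit z k).
  case: k e xk => [|k] e xk; first by [].
  have [w1 w2 w3] := gz k.+1.
  split=> //; rewrite e; first by apply: le_lt_trans w3 _; clear -w2; lra.
  have [k1 k2 _] := gz k.
  have [_ _ _ + _] := wedge_next (gz k) (strip_neq0 (good_strip k gz)).
  by rewrite -iterS; clear -k1 k2 => h1; lra.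
split=> //; split; first exact: nbhd_regionR.
move=> [/eqP + _]; rewrite -chart1_eq0// e; apply/negP.
exact: strip_neq0 (good_strip k gz).
Qed.

Lemma Xset_p0 : Xset nbhd (p0 R).
Proof.
have o k : Worbit (p0 R) k = p0 R by elim: k => //= k; rewrite /Worbit /= => ->; exact: W_p0.
split; first exact: nbhd_p0.
split; first by move=> k; rewrite o; split; [exact: (nbhd_regionR nbhd_p0)|case].
have -> : Worbit (p0 R) = fun=> p0 R by apply/funext.
exact: cvg_cst.
Qed.

Lemma good_Xset z : nbhd z -> good (chart z) -> Xset nbhd z.
Proof.
move=> nz gz; split=> //; split; first by move=> k; exact: (good_chart_nbhd k nz gz).2.
have [c1 c2] := good_cvg gz.
have -> : Worbit z = fun k => ((Worbit z k).1, (Worbit z k).2).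
  by apply/funext => k; case: (Worbit z k).
have x0 : 0 < z.1 by case: nz.
apply: (@cvg_pair _ _ _ _ (nbhs (2 : R)) (nbhs (0 : R)) _ _ _
  (fun k => (Worbit z k).1) (fun k => (Worbit z k).2)).
  have -> : (fun k => (Worbit z k).1) =
            (fun k => 2 * expR (iter k step (chart z)).1 ^+ 2).
    apply/funext => k; have [e xk] := chart_Worbit k x0.
    by rewrite (chart1_expR xk) e.
  have cu : {for (0 : R), continuous (fun u => 2 * expR u ^+ 2)}.
    apply: cvgMr; apply: (@continuous_comp _ _ _ (@expR R) (fun u => u ^+ 2)).
      exact: continuous_expR.
    exact: exprn_continuous.
  by have := cvg_comp _ _ c1 cu; rewrite expR0 expr1n mulr1.
apply/norm_cvg0P.
apply: (@squeeze_cvgr _ _ _ _ (fun=> 0) (fun k => (iter k step (chart z)).2)) => //.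
  apply: nearW => k; rewrite normr_ge0/=.
  have [[xk hk _] _] := good_chart_nbhd k nz gz.
  have [e _] := chart_Worbit k x0.
  by have /andP[_] := chart2_bounds xk (ltW hk); rewrite e.
exact: cvg_cst.
Qed.

Lemma chart1_Worbit_cvg z : 0 < z.1 -> Worbit z @ \oo --> p0 R ->
  (fun k => (iter k step (chart z)).1) @ \oo --> (0 : R).
Proof.
move=> x0 cv.
have cu : {for p0 R, continuous (fun w => (chart w).1)}.
  apply: (@continuous_comp _ _ _ (@chart R) (fun t : R * R => t.1)); last exact: cvg_fst.
  exact: (continuous_chart (z := p0 R) (ltr0n R 2)).
have -> : (fun k => (iter k step (chart z)).1) = (fun w => (chart w).1) \o Worbit z.
  by apply/funext => k; have [<- _] := chart_Worbit k x0.
by have := cvg_comp _ _ cv cu; rewrite chart_p0.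
Qed.

(** Induction on time. Leaving the wedge is excluded by [escape_invariant], as [h] tends to 0; the
    height stays positive because the orbit remains in [domW]. *)
Lemma Xset_good z : Xset nbhd z -> z.2 != 0 -> good (chart z).
Proof.
move=> [[x0 h r] [od cv]] y0.
have cvc := chart1_Worbit_cvg x0 cv.
have noesc k : (iter k step (chart z)).1 != 0 ->
    `|(iter k step (chart z)).1| <= 1 / 10 / 100 -> 0 <= (iter k step (chart z)).2 ->
    (iter k step (chart z)).2 <= 1 / 100 / 100 ->
    `|(iter k step (chart z)).1| <= 3 * (iter k step (chart z)).2.
  move=> h0 h1 r0 r1; rewrite leNgt; apply/negP => esc.
  have inv n := escape_invariant n h0 h1 r0 r1 (ltW esc).
  have cvs : (fun n => `|(iter n step (iter k step (chart z))).1|) @ \oo --> (0 : R).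
    have -> : (fun n => `|(iter n step (iter k step (chart z))).1|) =
              (fun n => `|(iter (n + k) step (chart z)).1|).
      by apply/funext => n; rewrite iterD.
    rewrite (cvg_shiftn k (fun n => `|(iter n step (chart z)).1|)).
    have cn := cvg_norm cvc.
    by rewrite normr0 in cn; exact: cn.
  have : `|(iter k step (chart z)).1| - (iter k step (chart z)).2 <= 0.
    rewrite -(cvg_lim _ cvs)//; apply: limr_ge; first by apply/cvg_ex; eexists; exact: cvs.
    exact: nearW.
  have := normr_gt0 (iter k step (chart z)).1; rewrite h0 => hp.
  by clear -hp esc r0; lra.
(* A point with [h = 0] and positive height would be on [x = 2] with [y] nonzero, outside [domW]. *)
have nz k : 0 < (iter k step (chart z)).2 -> (iter k step (chart z)).1 != 0.
  have [e xk] := chart_Worbit k x0; rewrite -e chart2_gt0// chart1_eq0// => yk.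
  by apply/eqP => x2; have [_] := od k; apply; split=> //; exact/eqP.
elim=> [|k ih].
  have r0 : 0 < (chart z).2 by rewrite chart2_gt0.
  by split=> //=; [exact: ltW|exact: (noesc 0%N (nz 0%N r0) (ltW h) (ltW r0) (ltW r))].
have [i1 i2 i3] := ih.
have [_ _ n1 n2 n3] := wedge_next ih (nz k i1).
rewrite -iterS in n1 n2 n3.
have rk : (iter k.+1 step (chart z)).2 <= 1 / 100 / 100 by clear -n2 i1 i2; lra.
split=> //; apply: noesc => //; [exact: nz|by clear -n3 i2; lra|exact: ltW].
Qed.

(** On [r = 0] every point satisfies the escape condition, so [|h|] never decreases and can tend to
    0 only if it is 0. *)
Lemma Xset_axis z : Xset nbhd z -> z.2 = 0 -> z = p0 R.
Proof.
move=> [[x0 h r] [od cv]] y0.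
have r0 : (chart z).2 = 0 by rewrite /= y0 normr0 mul0r.
have [h0|h0] := eqVneq (chart z).1 0; first exact: chart_eq0.
have inv n : `|(chart z).1| <= `|(iter n step (chart z)).1|.
  have := escape_invariant n h0 (ltW h); rewrite r0 subr0 mulr0 => /(_ (lexx 0)).
  by apply; rewrite ?divr_ge0.
have cvc : (fun k => `|(iter k step (chart z)).1|) @ \oo --> (0 : R).
  have h0' := cvg_norm (chart1_Worbit_cvg x0 cv).
  by rewrite normr0 in h0'; exact: h0'.
have : `|(chart z).1| <= 0.
  rewrite -(cvg_lim _ cvc)//; apply: limr_ge; first by apply/cvg_ex; eexists; exact: cvc.
  exact: nearW.
by rewrite normr_le0 (negbTE h0).
Qed.

Lemma Xset_W z : Xset nbhd z -> Xset nbhd (W z).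
Proof.
move=> Xz; have [y0|y0] := eqVneq z.2 0.
  by rewrite (Xset_axis Xz y0) W_p0; exact: Xset_p0.
have gz := Xset_good Xz y0; have nz : nbhd z by case: Xz.
apply: good_Xset; first by have [] := good_chart_nbhd 1 nz gz.
have x0 : 0 < z.1 by case: nz.
by have [-> _] := chart_W x0; exact: good_step.
Qed.

(** From [r ^ 2 / 10 <= r' <= 5 r ^ 2] and [r / 2 <= |y| <= r]: the upper constant is [5 * 4], the
    lower one [1 / 10 / 2]. *)
Lemma Xset_quadratic z : Xset nbhd z -> z.2 != 0 -> forall k,
  1 / 20 * `|(Worbit z k).2| ^+ 2 <= `|(Worbit z k.+1).2| <= 20 * `|(Worbit z k).2| ^+ 2.
Proof.
move=> Xz y0 k; have gz := Xset_good Xz y0; have nz : nbhd z by case: Xz.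
have x0 : 0 < z.1 by case: nz.
have [[xk hk _] _] := good_chart_nbhd k nz gz.
have [[xk' hk' _] _] := good_chart_nbhd k.+1 nz gz.
have [e _] := chart_Worbit k x0; have [e' _] := chart_Worbit k.+1 x0.
have /andP[b1 b2] := chart2_bounds xk (ltW hk).
have /andP[b3 b4] := chart2_bounds xk' (ltW hk').
rewrite e in b1 b2; rewrite e' in b3 b4.
have [n1 n2 _ _ _] := wedge_next (gz k) (strip_neq0 (good_strip k gz)).
rewrite -iterS in n1 n2.
have [rk _ _] := gz k.
set r := (iter k step (chart z)).2 in b1 b2 n1 n2 rk.
set r' := (iter k.+1 step (chart z)).2 in b3 b4 n1 n2.
set y := `|(Worbit z k).2| in b1 b2 *; set y' := `|(Worbit z k.+1).2| in b3 b4 *.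
have q1 : y * y <= r * r by apply: ler_pM => //; exact: normr_ge0.
have q2 : (r / 2) * (r / 2) <= y * y by apply: ler_pM => //; clear -rk; lra.
by rewrite !expr2 in n1 n2 *; clear -q1 q2 n1 n2 b3 b4; apply/andP; split; lra.
Qed.

(** A limit with [y = 0] has its chart in the closed cone [|h| <= 3 r], hence is [p0]. A limit with
    [y] nonzero is handled by [closure_good], once the points with [r <= 0] are split off. *)
Lemma Xset_closed : Xset nbhd = nbhd `&` closure (Xset nbhd).
Proof.
apply/seteqP; split=> z; first by move=> Xz; split; [case: Xz|exact: subset_closure].
move=> [nz cz]; have x0 : 0 < z.1 by case: nz.
have cc := closure_image (continuous_chart x0) cz.
have [y0|y0] := eqVneq z.2 0.
  suff -> : z = p0 R by exact: Xset_p0.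
  apply: chart_eq0 => //; last by rewrite /= y0 normr0 mul0r.
  have cl : closed [set w : R * R | 0 <= 3 * w.2 - `|w.1|].
    apply: (@preimage_closed _ _ (fun w : R * R => 3 * w.2 - `|w.1|) [set u | 0 <= u]).
      move=> w _; apply: cvgB; [apply: cvgMr; exact: cvg_snd|apply: cvg_norm; exact: cvg_fst].
    exact: closed_ge.
  have : closure [set w : R * R | 0 <= 3 * w.2 - `|w.1|] (chart z).
    apply: closureS cc => _ [w Xw <-]; rewrite /mkset.
    have [w0|w0] := eqVneq w.2 0.
      by rewrite (Xset_axis Xw w0) chart_p0/= mulr0 normr0 subrr.
    by rewrite subr_ge0; have [_ _] := Xset_good Xw w0 0%N.
  move/cl => /=; rewrite y0 normr0 mul0r mulr0 sub0r oppr_ge0 normr_le0 => /eqP.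
  by [].
have r0 : 0 < (chart z).2 by rewrite chart2_gt0.
apply: good_Xset => //; apply: closure_good => //.
have : closure (@good R `|` [set w | w.2 <= 0]) (chart z).
  apply: closureS cc => _ [w Xw <-].
  have [w0|w0] := eqVneq w.2 0; last by left; exact: Xset_good.
  by right; rewrite /= w0 normr0 mul0r.
rewrite closureU => -[//|cl].
have : closed [set w : R * R | w.2 <= 0].
  apply: (@preimage_closed _ _ (fun w : R * R => w.2) [set u | u <= 0]).
    by move=> w _; exact: cvg_snd.
  exact: closed_le.
by move=> /(_ _ cl) /=; rewrite leNgt r0.
Qed.

End StableSet.

(** * Measurability and nullity of the stable set *)

Section Measure.
Variable R : realType.

(** An open set is a countable union of boxes with rational centers; boxes not contained in [U] are
    replaced by the empty set. *)
Lemma open_measurable_prod (U : set (R * R)) : open U -> measurable U.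
Proof.
move=> oU.
pose B (p q : rat) n : set (R * R) :=
  `]ratr p - n.+1%:R^-1, ratr p + n.+1%:R^-1[ `*` `]ratr q - n.+1%:R^-1, ratr q + n.+1%:R^-1[.
have -> : U = \bigcup_p \bigcup_q \bigcup_n (if `[< B p q n `<=` U >] then B p q n else set0).
  apply/seteqP; split=> [z Uz|z [p _ [q _ [n _]]]]; last by case: asboolP => // BU /BU.
  have := oU; rewrite openE => /(_ _ Uz); rewrite /interior -nbhs_ballE => -[e /= e0 eU].
  have [n] := near_infty_natSinv_lt (PosNum (divr_gt0 e0 (ltr0n R 2))).
  move=> _ /(_ _ (leqnn n)) /=; set d := n.+1%:R^-1 => dE.
  have d0 : 0 < d :> R by rewrite invr_gt0.
  have [p] : exists q, ratr q \in `]z.1 - d, z.1[ by apply: rat_in_itvoo; rewrite ltrBlDr ltrDl.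
  have [q] : exists q, ratr q \in `]z.2 - d, z.2[ by apply: rat_in_itvoo; rewrite ltrBlDr ltrDl.
  rewrite !in_itv/= => /andP[q1 q2] /andP[p1 p2].
  exists p => //; exists q => //; exists n => //.
  case: asboolP => [_|[]].
    by split; rewrite /= in_itv/= -/d; apply/andP; split; clear -p1 p2 q1 q2 d0; lra.
  move=> w [/=]; rewrite !in_itv/= -/d => /andP[w1 w2] /andP[w3 w4].
  apply: eU; split; rewrite /ball/= ltr_norml; apply/andP; split;
    clear -w1 w2 w3 w4 p1 p2 q1 q2 dE; lra.
apply: bigcupT_measurable_rat => p; apply: bigcupT_measurable_rat => q.
apply: bigcupT_measurable => n; case: ifP => // _.
by apply: measurableX; exact: measurable_itv.
Qed.

(** One center per sign prefix, with an arbitrary one for an empty class. Prefixes starting with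
    true use the first [2 ^ n] indices, the others are shifted by [2 ^ n]. *)
Lemma prefix_cover (S : set R) (d : R) n (s : R -> nat -> bool) :
  (forall x y, S x -> S y -> (forall k, (k < n)%N -> s x k = s y k) -> `|x - y| <= d) ->
  exists c : nat -> R, forall x, S x -> exists2 k, (k < 2 ^ n)%N & `|x - c k| <= d.
Proof.
elim: n S s => [|n ih] S s hS.
  have [->|/set0P[x0 Sx0]] := eqVneq S set0; first by exists (fun=> 0).
  by exists (fun=> x0) => x Sx; exists 0%N => //; exact: hS.
have half b : exists c : nat -> R, forall x, (S `&` [set x | s x 0%N = b]) x ->
    exists2 k, (k < 2 ^ n)%N & `|x - c k| <= d.
  apply: (ih _ (fun x => s x \o succn)) => x y [Sx sx] [Sy sy] e.
  by apply: hS => // -[|k] kn; [rewrite sx sy|exact: e].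
have [c1 h1] := half true; have [c2 h2] := half false.
exists (fun k => if (k < 2 ^ n)%N then c1 k else c2 (k - 2 ^ n)%N) => x Sx.
case sx : (s x 0%N).
  have [k kn h] := h1 x (conj Sx sx); exists k; last by rewrite kn.
  by apply: leq_trans kn _; rewrite leq_exp2l.
have [k kn h] := h2 x (conj Sx sx); exists (k + 2 ^ n)%N.
  by rewrite expnS mul2n -addnn ltn_add2r.
by rewrite ltnNge leq_addl/= addnK.
Qed.

Lemma prefix_cover_measure (S : set R) (d : R) n (s : R -> nat -> bool) :
  measurable S -> 0 <= d ->
  (forall x y, S x -> S y -> (forall k, (k < n)%N -> s x k = s y k) -> `|x - y| <= d) ->
  (lebesgue_measure S <= (2 ^+ n * (2 * d))%:E)%E.
Proof.
move=> mS d0 /prefix_cover[c cP].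
apply: le_trans (_ : (\sum_(k < 2 ^ n) lebesgue_measure
    (`[(c k - d)%R, (c k + d)%R]%classic : set R) <= _)%E).
  apply: (@content_subadditive _ _ _ (@lebesgue_measure R) S
    (fun k => `[c k - d, c k + d]%classic) (2 ^ n)%N) => //.
  move=> x /cP[k kn]; rewrite ler_norml => /andP[k1 k2].
  rewrite -(bigcup_mkord (2 ^ n)%N (fun k => `[c k - d, c k + d]%classic)).
  exists k => //=; rewrite in_itv/=.
  by clear -k1 k2; apply/andP; split; lra.
apply: le_trans (_ : (\sum_(k < 2 ^ n) (2 * d)%:E <= _)%E).
  apply: lee_sum => k _; rewrite lebesgue_measure_itv/= lte_fin; case: ifP => _.
    by rewrite -EFinD lee_fin; clear; lra.
  by rewrite lee_fin mulr_ge0.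
by rewrite sumEFin lee_fin sumr_const card_ord -(mulr_natl (2 * d)) natrX.
Qed.

(** For fixed [y], [r] is a constant times [expR h] and [x = 2 expR (2 h)]. As [r] is small, two
    points of a horizontal line are in the cone of [cylinder_close]; the factor 6 comes from
    [x <= 3]. *)
Lemma chart_horizontal (x1 x2 y : R) : nbhd (x1, y) -> nbhd (x2, y) ->
  `|(chart (x1, y)).2 - (chart (x2, y)).2| <= `|(chart (x1, y)).1 - (chart (x2, y)).1| / 4 /\
  `|x1 - x2| <= 6 * `|(chart (x1, y)).1 - (chart (x2, y)).1|.
Proof.
wlog h12 : x1 x2 / (chart (x2, y)).1 <= (chart (x1, y)).1 => [hw n1 n2|].
  have [h|/ltW h] := leP (chart (x2, y)).1 (chart (x1, y)).1; first exact: hw.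
  by rewrite distrC (distrC (_.1)) (distrC x1); apply: hw.
move=> [x10 h1 r1] [x20 h2 r2].
have /andP[_ b1] := chart_box x10 (ltW h1).
have e1 := chart1_expR x10; have e2 := chart1_expR x20.
have r10 := chart2_ge0 (x1, y).
have rE : (chart (x2, y)).2 = (chart (x1, y)).2 * expR (- ((chart (x1, y)).1 - (chart (x2, y)).1)).
  have sE (z : R * R) : 0 < z.1 -> (chart z).2 = `|z.2| * (Num.sqrt 2 * expR (chart z).1).
    move=> z0; congr (_ * _); rewrite {1}(chart1_expR z0) sqrtrM ?ler0n// sqrtr_sqr.
    by rewrite (gtr0_norm (expR_gt0 _)).
  rewrite (sE _ x10) (sE _ x20) -!mulrA -expRD.
  by congr (_ * (_ * expR _)); clear; lra.
have xE : x2 = x1 * expR (- ((chart (x1, y)).1 - (chart (x2, y)).1)) ^+ 2.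
  rewrite [LHS]e2 [X in _ = X * _ ^+ 2]e1 -mulrA -exprMn -expRD.
  by congr (_ * expR _ ^+ 2); clear; lra.
rewrite /= in e1 e2 x10 x20 b1.
move: h12 rE xE r10 r1; move: (chart (x1, y)) (chart (x2, y)) => [u1 v1] [u2 v2] /=.
move=> h12 rE xE r10 r1 {h1 h2 r2 e1 e2}.
have [D0 D1] : 0 <= expR (- (u1 - u2)) /\ expR (- (u1 - u2)) <= 1.
  by rewrite expR_ge0 -expR0 ler_expR oppr_le0 subr_ge0.
have D2 := expR_ge1Dx (- (u1 - u2)).
move: (expR (- (u1 - u2))) rE xE D0 D1 D2 => D -> -> D0 D1 D2.
have q1 : v1 * (1 - D) <= 1 / 4 * (u1 - u2).
  by apply: ler_pM => //; clear -D1 D2 r1; lra.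
have q2 : x1 * (1 - D ^+ 2) <= 3 * (2 * (u1 - u2)).
  have : (1 - D) * (1 + D) <= (u1 - u2) * 2 by apply: ler_pM; clear -D0 D1 D2; lra.
  have DD : D * D <= 1 * 1 by apply: ler_pM.
  have -> : (1 - D) * (1 + D) = 1 - D ^+ 2 by clear; ring.
  move=> q; apply: ler_pM => //; [exact: ltW|by rewrite expr2; clear -DD; lra|].
  by clear -q; lra.
have q3 : 0 <= v1 * (1 - D) by rewrite mulr_ge0// subr_ge0.
have q4 : 0 <= x1 * (1 - D ^+ 2) by rewrite mulr_ge0 ?(ltW x10)// subr_ge0 expr_le1.
have -> : v1 - v1 * D = v1 * (1 - D) by clear; ring.
have -> : x1 - x1 * D ^+ 2 = x1 * (1 - D ^+ 2) by clear; ring.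
have u0 : 0 <= u1 - u2 by rewrite subr_ge0.
rewrite (ger0_norm q3) (ger0_norm q4) (ger0_norm u0).
by clear -q1 q2; split; lra.
Qed.

Lemma measurable_Xset : measurable (Xset (@nbhd R)).
Proof.
rewrite Xset_closed; apply: measurableI.
  exact: (open_measurable_prod (@nbhd_open R)).
rewrite -[closure _]setCK; apply: measurableC; apply: open_measurable_prod.
by apply: closed_openC; exact: closed_closure.
Qed.

Lemma Xset_section_null (y : R) : lebesgue_measure (ysection (Xset (@nbhd R)) y) = 0%E.
Proof.
have mS : measurable (ysection (Xset (@nbhd R)) y).
  by apply: measurable_ysection; exact: measurable_Xset.
have [y0|y0] := eqVneq y 0.
  apply/eqP; rewrite -measure_le0 -(lebesgue_measure_set1 (2 : R)).
  apply: le_measure; rewrite ?inE//.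
  by move=> x /ysectionP Xx; have [->] := Xset_axis Xx y0.
have bound n : (lebesgue_measure (ysection (Xset (@nbhd R)) y) <=
    (2 * (1 / 2 : R) ^+ n)%:E)%E.
  have d0 : 0 <= (1 / 4 : R) ^+ n by rewrite exprn_ge0// divr_ge0.
  have -> : 2 * (1 / 2) ^+ n = 2 ^+ n * (2 * (1 / 4) ^+ n) :> R.
    by rewrite mulrCA -exprMn; congr (_ * _ ^+ n); lra.
  apply: (@prefix_cover_measure _ _ n
    (fun x k => 0 < (iter k step (chart (x, y))).1) mS d0).
  (* Equal sign prefixes put both points in one cylinder. The prefactor [6 * 3 (r1 + r2)] is below
     1, leaving [4 ^ -n]. *)
  move=> x1 x2 /ysectionP X1 /ysectionP X2 e.
  have g1 := Xset_good X1 y0; have g2 := Xset_good X2 y0.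
  have [n1 _] := X1; have [n2 _] := X2.
  have [q1 q2] := chart_horizontal n1 n2.
  have c2 : cylinder n (fun k => 0 < (iter k step (chart (x1, y))).1) (chart (x2, y)).
    by split=> k kn; [exact: g2|rewrite e].
  have := cylinder_close (good_cylinder n g1) c2 q1.
  have [_ r1 _] : wedge (chart (x1, y)) by exact: g1 0%N.
  have [_ r2 _] : wedge (chart (x2, y)) by exact: g2 0%N.
  move=> q3; apply: (le_trans q2); apply: (@le_trans _ _ (6 * ((1 / 4) ^+ n * (1 / 6)))).
    rewrite ler_wpM2l//; apply: (le_trans q3); rewrite ler_wpM2l//.
    by clear -r1 r2; lra.
  by clear -d0; lra.
apply/eqP; rewrite -measure_le0.
have cv : (fun n => (2 * (1 / 2 : R) ^+ n)%:E) @ \oo --> 0%E.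
  apply: cvg_EFin; first exact: nearW.
  rewrite -[X in _ --> X](mulr0 2); apply: cvgMr; apply: cvg_expr.
  by rewrite ger0_norm; lra.
rewrite -(cvg_lim _ cv)//; apply: lime_ge; first by apply/cvg_ex; eexists; exact: cv.
by apply: nearW => n; exact: bound.
Qed.

(** Uniqueness of the product measure permits integrating over [y] the measures of the horizontal
    sections, which vanish. *)
Lemma Xset_negligible :
  ((@lebesgue_measure R) \x (@lebesgue_measure R))%E.-negligible (Xset (@nbhd R)).
Proof.
apply/negligibleP; first exact: measurable_Xset.
transitivity (((@lebesgue_measure R) \x^ (@lebesgue_measure R))%E (Xset (@nbhd R))).
  apply: product_measure_unique => //=; last exact: measurable_Xset.
  by move=> A B mA mB; rewrite product_measure2E.
rewrite /product_measure2 (eq_integral (fun=> 0%E)) ?integral0//.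
by move=> y _; exact: Xset_section_null.
Qed.

End Measure.

(** * Product structure: sign sequences times heights *)

Section Homeomorphism.
Variable R : realType.
Implicit Types (z : R * R) (s : nat -> bool).

Definition itinerary z : cantor_space := fun k => 0 < (iter k step z).1.

Lemma cantor_cvgP (T : Type) (F : set_system T) (f : T -> cantor_space) (c : cantor_space) :
  Filter F -> (forall k, \forall t \near F, f t k = c k) -> f @ F --> c.
Proof.
move=> FF h; apply/(pointwise_cvgP (U := nat) (V := bool)) => k B kB.
have Bk : B (c k) by exact: nbhs_singleton kB.
by apply: filterS (h k) => t /= ->.
Qed.

Lemma cantor_prefix_nbhs (c : cantor_space) n :
  nbhs c [set d : cantor_space | forall k, (k < n)%N -> d k = c k].
Proof.
elim: n => [|n ih]; first by apply: filterS filterT => d _ k.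
have hn : nbhs c [set d : cantor_space | d n = c n].
  exact: (@proj_continuous nat (fun=> bool) n c _ (discrete_set1 (c n))).
apply: filterS2 ih hn => d h1 h2 k; rewrite ltnS leq_eqVlt => /predU1P[->//|].
exact: h1.
Qed.

(** The orbit of a good point avoids the axis, so near each of its points [step] coincides with a
    single continuous branch. *)
Lemma continuous_iter_step z k : good z -> {for z, continuous (iter k step)}.
Proof.
move=> gz; elim: k => [|k ih]; first exact: cvg_id.
have n0 := strip_neq0 (good_strip k gz).
have c1 : {for iter k step z, continuous (fun w : R * R => w.1)} by exact: cvg_fst.
have cs : {for iter k step z, continuous (@step R)}.
  have bE : branch (0 < (iter k step z).1) (iter k step z) = step (iter k step z).
    by rewrite /step (negbTE n0).
  have := @continuous_branch R (0 < (iter k step z).1) (iter k step z).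
  rewrite /continuous_at bE; apply: cvg_trans; apply: near_eq_cvg.
  move: n0; rewrite neq_lt => /orP[n0|n0].
    have : \forall w \near iter k step z, w.1 < 0 by exact: cvgr_lt c1 _ n0.
    apply: filterS => w w0; rewrite /step (lt_eqF w0).
    by rewrite (ltNge 0 w.1) (ltW w0) (ltNge 0 _) (ltW n0).
  have : \forall w \near iter k step z, 0 < w.1 by exact: cvgr_gt c1 _ n0.
  by apply: filterS => w w0; rewrite /step (gt_eqF w0) w0 n0.
exact: (continuous_comp ih cs).
Qed.

Lemma continuous_itinerary z : good z -> {for z, continuous itinerary}.
Proof.
move=> gz; apply: cantor_cvgP => k.
have c1 : {for z, continuous (fun w : R * R => (iter k step w).1)}.
  apply: (@continuous_comp _ _ _ (iter k (@step R)) (fun w : R * R => w.1)).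
    exact: continuous_iter_step.
  exact: cvg_fst.
have := strip_neq0 (good_strip k gz); rewrite neq_lt /itinerary => /orP[n0|n0].
  have : \forall w \near z, (iter k step w).1 < 0 by exact: cvgr_lt c1 _ n0.
  by apply: filterS => w w0; rewrite (ltNge 0 _) (ltW w0) (ltNge 0 _) (ltW n0).
have : \forall w \near z, 0 < (iter k step w).1 by exact: cvgr_gt c1 _ n0.
by apply: filterS => w w0; rewrite w0 n0.
Qed.

Lemma homeomorphic_Xset :
  homeomorphic_sets (Xset (@nbhd R) `&` [set z | 0 < z.2])
    ([set: cantor_space] `*` `]0, (1 / 100 / 100 : R)[%classic).
Proof.
(* [sel s r] is the abscissa with signs [s] at height [r], and 0 for heights out of range. *)
have [sel selP] : exists sel : cantor_space -> R -> R,
    forall s r, 0 < r -> r <= 1 / 100 / 100 -> forall n, cylinder n s (sel s r, r).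
  have /choice[sel selP] : forall p : cantor_space * R, exists h,
      0 < p.2 -> p.2 <= 1 / 100 / 100 -> forall n, cylinder n p.1 (h, p.2).
    move=> [s r] /=; have [r0|r0] := ltP 0 r; last by exists 0.
    have [r1|r1] := leP r (1 / 100 / 100); last by exists 0.
    by have [h hP] := cylinder_exists s r0 r1; exists h.
  by exists (fun s r => sel (s, r)) => s r; exact: (selP (s, r)).
have gsel s r : 0 < r -> r < 1 / 100 / 100 -> good (sel s r, r).
  by move=> r0 r1; apply: (@cylinder_good _ s) => n; apply: selP => //; exact: ltW.
have Xgood z : (Xset (@nbhd R) `&` [set z | 0 < z.2]) z ->
    [/\ 0 < z.1, good (chart z), 0 < (chart z).2 & (chart z).2 < 1 / 100 / 100].
  move=> [Xz z0]; have [[x0 _ r1] _] := Xz.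
  by split=> //; [exact: (Xset_good Xz (lt0r_neq0 z0))|rewrite chart2_gt0// gt_eqF].
exists (fun z => (itinerary (chart z), (chart z).2)).
exists (fun p : cantor_space * R => unchart (sel p.1 p.2, p.2)).
split; split.
- move=> z /Xgood[_ _ r0 r1]; split=> //=.
  by rewrite in_itv/=; apply/andP; split.
- move=> [s r] [_] /=; rewrite in_itv/= => /andP[r0 r1].
  have gs := gsel s r r0 r1; have [_ _ hs] := gs 0%N; rewrite /= in hs.
  have e : chart (unchart (sel s r, r)) = (sel s r, r) by apply: unchartK; exact: ltW.
  have x0 : 0 < (unchart (sel s r, r)).1 by rewrite /= mulr_gt0// expR_gt0.
  split; last by rewrite /= divr_gt0// sqrtr_gt0.
  apply: good_Xset; last by rewrite e.
  split=> //; rewrite e//=; apply: le_lt_trans hs _.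
  by clear -r1 r0; lra.
- move=> z Xz; have [x0 gz r0 r1] := Xgood z Xz.
  have [_ z0] := Xz; rewrite -[RHS]chartK//; last exact: ltW.
  congr unchart; apply: (@cylinder_eq _ (itinerary (chart z))) => // n.
    by apply: selP => //; exact: ltW.
- move=> [s r] [_ rI].
  have /andP[r0 r1] : 0 < r < 1 / 100 / 100 by move: rI; rewrite /= in_itv.
  have e : chart (unchart (sel s r, r)) = (sel s r, r) by apply: unchartK; exact: ltW.
  rewrite -[LHS]/(itinerary (chart (unchart (sel s r, r))),
    (chart (unchart (sel s r, r))).2) e.
  suff -> : itinerary (sel s r, r) = s by [].
  (* The sign at time [k] is recorded by the cylinder of order [k.+1]. *)
  by apply: (@boolp.funext nat bool) => k; exact: (selP s r r0 (ltW r1) k.+1).2 k (ltnSn k).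
- apply: continuous_in_subspaceT => z; rewrite inE => /Xgood[x0 gz r0 r1].
  have cc := continuous_chart x0.
  apply: (@continuous_pair _ _ _ (fun z => itinerary (chart z)) (fun z => (chart z).2)).
    by apply: (@continuous_comp _ _ _ (@chart R) itinerary);
      [exact: cc|exact: continuous_itinerary].
  by apply: (@continuous_comp _ _ _ (@chart R) (fun w : R * R => w.2)); [exact: cc|exact: cvg_snd].
- apply: continuous_in_subspaceT => -[s r]; rewrite inE => -[_] /=.
  rewrite in_itv/= => /andP[r0 r1].
  apply: (@continuous_comp _ _ _ (fun p : cantor_space * R => (sel p.1 p.2, p.2)) (@unchart R));
    last exact: continuous_unchart.
  apply: (@continuous_pair _ _ _ (fun p : cantor_space * R => sel p.1 p.2)
    (fun p : cantor_space * R => p.2)); last exact: cvg_snd.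
  apply/cvgrPdist_lt => e e0 /=.
  have [n ne] : exists n, (1 / 4 : R) ^+ n < e.
    have cv : (fun n => (1 / 4 : R) ^+ n) @ \oo --> (0 : R).
      by apply: cvg_expr; rewrite ger0_norm; lra.
    have [n _ /(_ n (leqnn n)) /=] := cvgr_lt _ cv _ e0.
    by exists n.
  have c1 : \forall p \near (s, r), forall k, (k < n)%N -> p.1 k = s k.
    exact: (@cvg_fst _ _ (nbhs s) (nbhs r) _ _ (cantor_prefix_nbhs s n)).
  have c2 : {for (s, r), continuous (fun p : cantor_space * R => p.2)} by exact: cvg_snd.
  have c3 : {for (s, r), continuous (fun p : cantor_space * R => `|r - p.2|)}.
    by apply: cvg_norm; apply: cvgB; [exact: cvg_cst|exact: c2].
  near=> p.
  have p0 : 0 < p.2 by near: p; exact: cvgr_gt c2 _ r0.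
  have p1 : p.2 < 1 / 100 / 100 by near: p; exact: cvgr_lt c2 _ r1.
  have pr : `|r - p.2| < e / 4.
    by near: p; apply: (cvgr_lt _ c3); rewrite subrr normr0 divr_gt0.
  have ps : forall k, (k < n)%N -> p.1 k = s k by near: p; exact: c1.
  (* Outside the cone [|dh| < 4 |dr| < e]. Inside it the two points share a cylinder of order [n],
     so [|dh|] is at most [4 ^ -n < e]. *)
  have [cone|cone] := leP `|r - p.2| (`|sel s r - sel p.1 p.2| / 4); last first.
    by move: pr cone; clear; move=> *; lra.
  have cp : cylinder n s (sel p.1 p.2, p.2).
    have [q1 q2] := selP p.1 p.2 p0 (ltW p1) n.
    by split=> // k kn; rewrite q2// ps.
  apply: le_lt_trans (cylinder_close (selP s r r0 (ltW r1) n) cp cone) _.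
  apply: le_lt_trans ne; rewrite ler_piMr ?exprn_ge0 ?divr_ge0//=.
  by clear -r1 p1; lra.
Unshelve. all: by end_near. Qed.

End Homeomorphism.

Unset Implicit Arguments.

Theorem theorem5p1 (R : realType) :
  exists A : set (R * R),
    [/\ open A, A `<=` @regionR R, A (@p0 R) &
      let X := Xset A in
      [/\ (exists C : set (R * R), closed C /\ X = A `&` C),
          ((@lebesgue_measure R) \x (@lebesgue_measure R))%E.-negligible X,
          (forall z, X z -> X (W z)),
          (forall z0, X z0 -> (z0.2 != 0) ->
             exists c C : R, [/\ 0 < c, 0 < C &
               forall k, c * `|(Worbit z0 k).2| ^+ 2 <= `|(Worbit z0 k.+1).2|
                         <= C * `|(Worbit z0 k).2| ^+ 2]) &
          exists a b : R, a < b /\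
            homeomorphic_sets (X `&` [set z | 0 < z.2])
              ([set: cantor_space] `*` `]a, b[%classic)]].
Proof.
exists (@nbhd R); split.
- exact: nbhd_open.
- exact: nbhd_regionR.
- exact: nbhd_p0.
split.
- exists (closure (Xset (@nbhd R))); split; first exact: closed_closure.
  exact: Xset_closed.
- exact: Xset_negligible.
- exact: Xset_W.
- move=> z Xz z0; exists (1 / 20), 20; split=> //.
  exact: Xset_quadratic.
- exists 0, (1 / 100 / 100); split; last exact: homeomorphic_Xset.
  by rewrite !divr_gt0.
Qed.
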